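(* Let $W=(W_i,w_i)_{i\in I}$ and $V=(V_i,v_i)_{i\in I}$ be Bessel fusion sequences in a Hilbert space $\mathcal H$ and let $O\in\mathcal B(\mathcal H)$. For $0<p<\infty$ the following hold (the statements concerning $\mathcal M_\otimes^{(W,V)}$ being for $W,V$ fusion frames, where it is defined). (1) If $O$ is compact, then $\mathcal M^{(W,V)}(O)$ and $\mathcal M_\otimes^{(W,V)}(O)$ are compact. (2) If $O\in S_p(\mathcal H)$, then $\mathcal M^{(W,V)}(O),\ \mathcal M_\otimes^{(W,V)}(O)\in S_p\left(\left(\sum\bigoplus V_i\right)_{\ell^2},\left(\sum\bigoplus W_i\right)_{\ell^2}\right)$. When $W$ and $V$ are fusion frames, the implications in (1) and (2) are equivalences.
   Context: $\mathcal B(\mathcal H)$ is the space of bounded operators on $\mathcal H$; $\pi_U$ is the orthogonal projection onto a closed subspace $U$. For $0<p<\infty$, $S_p(X,Y)$ denotes the Schatten $p$-class: compact operators $X\to Y$ whose singular value sequence is in $\ell^p$; $S_p(X)=S_p(X,X)$. A Bessel fusion sequence in $\mathcal H$ is a family $W=(W_i,w_i)_{i\in I}$ of closed subspaces $W_i\subseteq\mathcal H$ and weights $w_i>0$ with $\sum_iw_i^2\|\pi_{W_i}f\|^2\le B_W\|f\|^2$ for all $f\in\mathcal H$ and some $B_W<\infty$; it is a fusion frame if also $A_W\|f\|^2\le\sum_iw_i^2\|\pi_{W_i}f\|^2$ for some $A_W>0$. $\left(\sum\bigoplus W_i\right)_{\ell^2}$ is the Hilbert space of $\{f_i\}_{i\in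 I}$ with $f_i\in W_i$, $\sum\|f_i\|^2<\infty$. Synthesis operator: $T_W\{f_i\}=\sum_iw_if_i$, with adjoint $T_W^*f=\{w_i\pi_{W_i}f\}_i$; $S_W=T_WT_W^*$, which is positive and invertible when $W$ is a fusion frame. $\mathcal M^{(W,V)}(O)=T_W^*OT_V$, and for fusion frames $\mathcal M_\otimes^{(W,V)}(O)=T_W^*S_W^{-1/2}OS_V^{-1/2}T_V$. *)

(* Defs.v *)
From HB Require Import structures.
From mathcomp Require Import all_boot all_order all_algebra finmap complex.
From mathcomp Require Import sesquilinear ring.
From mathcomp Require Import boolp classical_sets functions cardinality fsbigop.
From mathcomp Require Import reals ereal topology normedtype sequences esum exp.

Set Implicit Arguments.
Unset Strict Implicit.
Unset Printing Implicit Defensive.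

Import Order.TTheory GRing.Theory Num.Theory.
Import numFieldNormedType.Exports.

Local Open Scope classical_set_scope.
Local Open Scope ring_scope.

(* Scalar fields of Hilbert spaces.  The axioms force rc_field to be R (with
   trivial conjugation) or R(sqrt -1) with its usual conjugation and modulus;
   both occur, see rclike_real and rclike_complex. *)
Record rclike (R : realType) := RCLike {
  rc_field :> numFieldType;
  rc_conj : {rmorphism rc_field -> rc_field};
  rc_of : {rmorphism R -> rc_field};
  rc_re : rc_field -> R;
  rc_norm_of : forall r, `|rc_of r| = rc_of `|r|;
  rc_mul_conj : forall z, z * rc_conj z = `|z| ^+ 2;
  rc_add_conj : forall z, z + rc_conj z = rc_of (rc_re z) *+ 2 }.

Section rclike_instances.
Variable R : realType.

Let real_mul_conj (x : R) : x * idfun x = `|x| ^+ 2.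
Proof. by rewrite real_normK ?num_real. Qed.

Definition rclike_real : rclike R :=
  @RCLike R R idfun idfun idfun (fun=> erefl) real_mul_conj (fun=> erefl).

Let complex_norm_of (r : R) : `|real_complex R r| = real_complex R `|r|.
Proof. by rewrite normc_def /= expr0n addr0 sqrtr_sqr. Qed.

Let complex_mul_conj (z : R[i]) : z * conjc z = `|z| ^+ 2.
Proof.
case: z => a b; rewrite -add_Re2_Im2 /=; apply/eqP; rewrite eq_complex /=.
by rewrite mulrN opprK -!expr2 mulrN (mulrC b) addNr !eqxx.
Qed.

Let complex_add_conj (z : R[i]) :
  z + conjc z = real_complex R (complex.Re z) *+ 2.
Proof. by rewrite addcJ mulr_natl. Qed.

Definition rclike_complex : rclike R := @RCLike R R[i] (@conjc R)
  (real_complex R) (@complex.Re R) complex_norm_of complex_mul_conj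
  complex_add_conj.

End rclike_instances.

HB.mixin Record isHilbert (R : realType) (K : rclike R) H
    of CompleteNormedModule K H := {
  inner : {dot H for rc_conj K};
  inner_norm : forall x, inner x x = `|x| ^+ 2 }.

#[short(type="hilbertType")]
HB.structure Definition Hilbert (R : realType) (K : rclike R) :=
  {H of CompleteNormedModule K H & isHilbert R K H}.

Arguments inner {R K s} : rename.

Section rclike_theory.
Variables (R : realType) (K : rclike R).
Implicit Types (r : R) (z : K).
Local Notation of_ := (@rc_of R K).
Local Notation re := (@rc_re R K).

Lemma rc_of_inj : injective of_.
Proof. exact: fmorph_inj. Qed.

Lemma rc_conj_of r : rc_conj K (of_ r) = of_ r.
Proof.
have [->|r0] := eqVneq r 0; first by rewrite !rmorph0.
have := rc_mul_conj (of_ r); rewrite rc_norm_of -rmorphXn/= real_normK ?num_real//.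
by rewrite rmorphXn expr2; apply: mulfI; rewrite fmorph_eq0.
Qed.

Lemma rc_ofK r : re (of_ r) = r.
Proof.
have := rc_add_conj (of_ r); rewrite rc_conj_of -mulr2n -!rmorphMn.
move=> /rc_of_inj; rewrite -(mulr_natr r) -[RHS]mulr_natr => /esym.
by apply: mulIf; rewrite pnatr_eq0.
Qed.

Lemma rc_reE z : of_ (re z) = (z + rc_conj K z) / 2.
Proof.
by rewrite rc_add_conj -mulr_natr mulfK// pnatr_eq0.
Qed.

Lemma rc_reD z w : re (z + w) = re z + re w.
Proof.
by apply: rc_of_inj; rewrite rmorphD/= !rc_reE rmorphD/= -mulrDl addrACA.
Qed.

Lemma rc_reZ r z : re (of_ r * z) = r * re z.
Proof.
by apply: rc_of_inj; rewrite rmorphM/= !rc_reE rmorphM/= rc_conj_of -mulrDr mulrA.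
Qed.

Lemma rc_re_real z : z \is Num.real -> of_ (re z) = z.
Proof.
move=> zr; rewrite rc_reE.
suff -> : rc_conj K z = z by rewrite -mulr2n -(mulr_natr z) mulfK// pnatr_eq0.
have [->|z0] := eqVneq z 0; first by rewrite rmorph0.
have := rc_mul_conj z; rewrite real_normK// expr2; exact: mulfI.
Qed.

Lemma rc_of_ge0 r : (0 <= of_ r) = (0 <= r).
Proof.
apply/idP/idP => [r0|r0]; last by rewrite -(ger0_norm r0) -rc_norm_of.
have := ger0_norm r0; rewrite rc_norm_of => /rc_of_inj <-; exact: normr_ge0.
Qed.

Lemma rc_of_le r s : (of_ r <= of_ s) = (r <= s).
Proof. by rewrite -subr_ge0 -rmorphB rc_of_ge0 subr_ge0. Qed.

Lemma rc_of_lt r s : (of_ r < of_ s) = (r < s).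
Proof. by rewrite !lt_neqAle rc_of_le (inj_eq rc_of_inj). Qed.

Lemma rc_of_gt0 r : (0 < of_ r) = (0 < r).
Proof. by rewrite -rc_of_lt rmorph0. Qed.

Lemma rc_conjK : involutive (rc_conj K).
Proof.
move=> z; have [->|z0] := eqVneq z 0; first by rewrite !rmorph0.
have cz0 : rc_conj K z != 0 by rewrite fmorph_eq0.
have e := rc_mul_conj z.
have : rc_conj K (z * rc_conj K z) = z * rc_conj K z.
  by rewrite e -(@rc_re_real (`|z| ^+ 2)) ?rc_conj_of// ger0_real ?exprn_ge0.
by rewrite rmorphM/= (mulrC z); exact: mulfI.
Qed.

(* j plays the part of the imaginary unit, and j = 0 over the reals *)
Lemma rc_unit : exists j : K, forall z,
  z = of_ (re z) + of_ (re (z * rc_conj K j)) * j.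
Proof.
have [[y yc]|nc] := pselect (exists y, rc_conj K y != y); last first.
  exists 0 => z; rewrite mulr0 addr0 rc_reE.
  have -> : rc_conj K z = z.
    by have [//|h] := eqVneq (rc_conj K z) z; exfalso; apply: nc; exists z.
  by rewrite -mulr2n -(mulr_natr z) mulfK// pnatr_eq0.
set d := y - rc_conj K y.
have d0 : d != 0 by rewrite subr_eq0 eq_sym.
have dc : rc_conj K d = - d by rewrite rmorphB/= rc_conjK opprB.
have d2 : d ^+ 2 = - `|d| ^+ 2.
  by rewrite -rc_mul_conj dc mulrN opprK.
have nc : rc_conj K `|d| = `|d|.
  by rewrite -(@rc_re_real `|d|) ?ger0_real// rc_conj_of.
have n0 : `|d| != 0 by rewrite normr_eq0.
set j := d / `|d|.
have jc : rc_conj K j = - j by rewrite rmorphM fmorphV/= nc dc mulNr.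
have jj : j * j = -1.
  by rewrite -expr2 expr_div_n d2 mulNr divff// expf_neq0.
exists j => z; rewrite !rc_reE jc rmorphM rmorphN/= jc opprK.
have -> : (z * - j + rc_conj K z * j) / 2 * j =
          (rc_conj K z - z) * (j * j) / 2.
  by rewrite mulrAC mulrDl mulrBl mulrN mulNr -!mulrA addrC.
rewrite jj mulrN1 opprB -mulrDl addrACA subrr addr0.
by rewrite -mulr2n -(mulr_natr z) mulfK// pnatr_eq0.
Qed.
Lemma rc_norm_conj z : `|rc_conj K z| = `|z|.
Proof.
apply/eqP; rewrite -(@eqrXn2 _ 2)//; apply/eqP.
by rewrite -!rc_mul_conj rc_conjK mulrC.
Qed.

End rclike_theory.

(* the filter of eventually large finite subsets of I *)
Definition totally (I : choiceType) : set_system {fset I} :=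
  filter_from setT (fun A => [set B : {fset I} | (A `<=` B)%fset]).

Instance totally_filter (I : choiceType) : ProperFilter (@totally I).
Proof.
eapply filter_from_proper; last by move=> A _; exists A => /=.
apply: filter_fromT_filter; first by exists fset0.
move=> A B; exists (A `|` B)%fset => C /=; rewrite fsubUset.
by move/andP=> [AC BC]; split.
Qed.

(* unordered sum, with the lim junk value when it does not converge *)
Definition usum (F : numFieldType) (E : normedModType F) (I : choiceType)
  (f : I -> E) : E := lim ((fun J : {fset I} => \sum_(i <- J) f i) @ @totally I).

Section cvg_theory.
Variables (R : realType) (K : rclike R) (I : choiceType).

Lemma cvg_esum (a : I -> R) : (forall i, 0 <= a i) ->
  (\esum_(i in setT) (a i)%:E < +oo)%E ->
  (fun J : {fset I} => \sum_(i <- J) a i) @ @totally I -->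
    fine (\esum_(i in setT) (a i)%:E)%E.
Proof.
move=> a0 foo.
have ge0 : (0 <= \esum_(i in setT) (a i)%:E)%E.
  by apply: esum_ge0 => i _; rewrite lee_fin.
have fin : (\esum_(i in setT) (a i)%:E)%E \is a fin_num by rewrite ge0_fin_numE.
set s := fine _.
have sE : (\esum_(i in setT) (a i)%:E)%E = s%:E by rewrite fineK.
have sup (J : {fset I}) : \sum_(i <- J) a i <= s.
  rewrite -lee_fin -sE -sumEFin; apply: esum_ge; exists [set` J]; first by split.
  by rewrite fsbig_finite//= set_fsetK.
apply/cvgrPdist_le => /= e e0.
have /ub_ereal_sup_adherent : (0 < e)%R by [].
move=> /(_ [set \sum_(x \in A) (a x)%:E | A in fsets setT]%E).
rewrite -/(esum _ _) => /(_ fin)[_ [A [fA _] <-]] Ae.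
exists (fset_set A) => //= B /= AB.
rewrite ger0_norm ?subr_ge0// lerBlDr -lerBlDl.
apply: (@le_trans _ _ (\sum_(i <- fset_set A) a i)); last first.
  rewrite [leRHS](big_fsetID _ (mem (fset_set A)))/=.
  rewrite (_ : [fset x | x in B & x \in fset_set A]%fset = fset_set A).
    by rewrite lerDl; exact: sumr_ge0.
  apply/fsetP => i; rewrite !inE /=.
  have [/(fsubsetP AB) -> //|_] := boolP (i \in fset_set A); by rewrite ?andbF ?andbT.
move: Ae; rewrite fsbig_finite//= sumEFin sE -EFinD => /ltW.
by rewrite lee_fin.
Qed.

Lemma cvg_rc_of (T : Type) (F : set_system T) (FF : Filter F) (f : T -> R) (l : R) :
  f x @[x --> F] --> l -> rc_of K (f x) @[x --> F] --> (rc_of K l : K).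
Proof.
move=> /cvgrPdist_lt fl; apply/cvgrPdist_lt => e e0.
have er : rc_of K (rc_re e) = e by rewrite rc_re_real// gtr0_real.
have re0 : 0 < rc_re e by rewrite -(rc_of_gt0 K) er.
near=> x; rewrite -rmorphB rc_norm_of -er rc_of_lt.
by near: x; exact: fl.
Unshelve. all: by end_near. Qed.

End cvg_theory.

Section rnorm_theory.
Variables (R : realType) (K : rclike R).

(* the norm as an element of R instead of K *)
Definition rnorm (E : normedModType K) (x : E) : R := rc_re `|x|.

Lemma rnormE (E : normedModType K) (x : E) : rc_of K (rnorm x) = `|x|.
Proof. by rewrite /rnorm rc_re_real// ger0_real. Qed.

Lemma rnorm_ge0 (E : normedModType K) (x : E) : 0 <= rnorm x.
Proof. by rewrite -(rc_of_ge0 K) rnormE. Qed.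

Lemma rnorm0 (E : normedModType K) : rnorm (0 : E) = 0.
Proof. by apply: (@rc_of_inj _ K); rewrite rnormE rmorph0 normr0. Qed.

Lemma rnormZ (E : normedModType K) (a : K) (x : E) :
  rnorm (a *: x) = rc_re `|a| * rnorm x.
Proof.
apply: (@rc_of_inj _ K); rewrite rmorphM/= !rnormE.
exact: normrZ.
Qed.

Lemma rnormD (E : normedModType K) (x y : E) : rnorm (x + y) <= rnorm x + rnorm y.
Proof. by rewrite -(rc_of_le K) rmorphD/= !rnormE ler_normD. Qed.

Lemma cvg_rnorm (E : normedModType K) (T : Type) (F : set_system T)
    (FF : Filter F) (f : T -> E) (l : E) :
  f x @[x --> F] --> l -> rnorm (f x) @[x --> F] --> rnorm l.
Proof.
move=> /cvg_norm/cvgrPdist_lt fl; apply/cvgrPdist_lt => e e0; near=> x.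
rewrite -(rc_of_lt K) -rc_norm_of rmorphB/= !rnormE.
by near: x; apply: fl; rewrite rc_of_gt0.
Unshelve. all: by end_near. Qed.

Variable H : hilbertType K.
Implicit Types x y : H.

Lemma rc_innerxx x : rc_of K (rnorm x ^+ 2) = inner x x.
Proof. by rewrite inner_norm rmorphXn/= rnormE. Qed.

Lemma inner_conj x y : inner x y = rc_conj K (inner y x).
Proof. by rewrite hermC expr0 mul1r. Qed.

Lemma rc_re_conj (z : K) : rc_re (rc_conj K z) = rc_re z.
Proof. by apply: (@rc_of_inj _ K); rewrite !rc_reE rc_conjK addrC. Qed.

Lemma rnormD2 x y :
  rnorm (x + y) ^+ 2 = rnorm x ^+ 2 + rnorm y ^+ 2 + rc_re (inner x y) *+ 2.
Proof.
apply: (@rc_of_inj _ K); rewrite rmorphD/= rmorphMn/= rmorphD/= !rc_innerxx.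
rewrite linearDl !linearDr/= -rc_add_conj -inner_conj.
by ring.
Qed.

End rnorm_theory.

Record closed_subspace (R : realType) (K : rclike R) (H : hilbertType K) :=
  ClosedSubspace {
  cs_set :> set H;
  cs_closed : closed cs_set;
  cs_zero : cs_set 0;
  cs_lin : forall (a : K) x y, cs_set x -> cs_set y -> cs_set (a *: x + y) }.

Section esum_aux.
Variables (R : realType) (I : choiceType) (a : I -> R).

Lemma esum_le_fset (M : R) : (forall J : {fset I}, \sum_(i <- J) a i <= M) ->
  (\esum_(i in setT) (a i)%:E <= M%:E)%E.
Proof.
move=> aM; apply: ge_ereal_sup => _ [X [fX _] <-].
by rewrite fsbig_finite//= sumEFin lee_fin.
Qed.

Lemma fset_le_esum (J : {fset I}) :
  (\sum_(i <- J) (a i)%:E <= \esum_(i in setT) (a i)%:E)%E.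
Proof.
apply: esum_ge; exists [set` J]; first by split.
by rewrite fsbig_finite//= set_fsetK.
Qed.
End esum_aux.

Section ell2_def.
Variables (R : realType) (K : rclike R) (H : hilbertType K) (I : choiceType).
Variable U : I -> closed_subspace H.

Definition ell2_pred : {pred I -> H} := fun f =>
  `[< (forall i, cs_set (U i) (f i)) /\
      (\esum_(i in setT) (rnorm (f i) ^+ 2)%:E < +oo)%E >].

Lemma ell2_submod_closed : submod_closed ell2_pred.
Proof.
split.
  apply/asboolP; split => [i|]; first exact: cs_zero.
  by rewrite esum1// => i _; rewrite rnorm0 expr0n.
move=> c f g /asboolP[Uf foo] /asboolP[Ug goo]; apply/asboolP.
split => [i|]; first exact: cs_lin.
set A := esum _ _ in foo; set B := esum _ _ in goo.
have A0 : (0 <= A)%E by apply: esum_ge0 => i _; rewrite lee_fin sqr_ge0.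
have B0 : (0 <= B)%E by apply: esum_ge0 => i _; rewrite lee_fin sqr_ge0.
have Af : A \is a fin_num by rewrite ge0_fin_numE.
have Bf : B \is a fin_num by rewrite ge0_fin_numE.
have c0 : 0 <= rc_re `|c| by rewrite -(rc_of_ge0 K) rc_re_real// ger0_real.
apply: (@le_lt_trans _ _ (2 * (rc_re `|c| ^+ 2) * fine A + 2 * fine B)%:E);
  last exact: ltry.
apply: esum_le_fset => J.
apply: (@le_trans _ _ (\sum_(i <- J) (2 * (rc_re `|c| ^+ 2) * rnorm (f i) ^+ 2 +
   2 * rnorm (g i) ^+ 2))).
  apply: ler_sum => i _; apply: (@le_trans _ _ ((rc_re `|c| * rnorm (f i) + rnorm (g i)) ^+ 2)).
    rewrite lerXn2r ?nnegrE ?rnorm_ge0 ?addr_ge0 ?mulr_ge0 ?rnorm_ge0//.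
    by rewrite -rnormZ; exact: rnormD.
  rewrite -subr_ge0.
  rewrite (_ : _ - _ = (rc_re `|c| * rnorm (f i) - rnorm (g i)) ^+ 2) ?sqr_ge0//.
  by ring.
rewrite big_split/= -!mulr_sumr lerD//.
  rewrite ler_wpM2l ?mulr_ge0 ?sqr_ge0// -lee_fin fineK// -sumEFin.
  exact: fset_le_esum.
rewrite ler_wpM2l// -lee_fin fineK// -sumEFin.
exact: fset_le_esum.
Qed.

HB.instance Definition _ :=
  GRing.isSubmodClosed.Build K (I -> H) ell2_pred ell2_submod_closed.

(* the l^2 direct sum of the U i *)
Record ell2 := Ell2 { ell2_fun :> I -> H; ell2P : ell2_fun \in ell2_pred }.

HB.instance Definition _ := [isSub for ell2_fun].
HB.instance Definition _ := [Choice of ell2 by <:].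
HB.instance Definition _ := [SubChoice_isSubLmodule of ell2 by <:].

End ell2_def.

Section ell2_inner_def.
Variables (R : realType) (K : rclike R) (H : hilbertType K) (I : choiceType).
Variable U : I -> closed_subspace H.
Local Notation E := (ell2 U).
Implicit Types f g h : E.

Definition ell2_inner f g : K := usum (fun i => inner (f i) (g i) : K^o).

Lemma ell2D f g i : ell2_fun (f + g) i = f i + g i. Proof. by []. Qed.
Lemma ell2Z a f i : ell2_fun (a *: f) i = a *: f i. Proof. by []. Qed.
Lemma ell20 i : ell2_fun (0 : ell2 U) i = 0. Proof. by []. Qed.
Lemma ell2N f i : ell2_fun (- f) i = - f i. Proof. by []. Qed.
Lemma ell2U f i : cs_set (U i) (f i).
Proof. by case: f => f /= /asboolP[]. Qed.
Lemma ell2_ext f g : (forall i, f i = g i) -> f = g.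
Proof. by move=> fg; apply/val_inj/funext. Qed.

Definition ell2_nsq f := fine (\esum_(i in setT) (rnorm (f i) ^+ 2)%:E)%E.

Lemma ell2_lty f : (\esum_(i in setT) (rnorm (f i) ^+ 2)%:E < +oo)%E.
Proof. by case: f => f /= /asboolP[]. Qed.

Lemma ell2_nsqE f :
  (\esum_(i in setT) (rnorm (f i) ^+ 2)%:E)%E = (ell2_nsq f)%:E.
Proof.
rewrite fineK// ge0_fin_numE ?ell2_lty//.
by apply: esum_ge0 => i _; rewrite lee_fin sqr_ge0.
Qed.

Lemma cvg_ell2_nsq f : (fun J : {fset I} => \sum_(i <- J) rnorm (f i) ^+ 2) @ @totally I -->
  ell2_nsq f.
Proof. by apply: cvg_esum => [i|]; [exact: sqr_ge0|exact: ell2_lty]. Qed.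

Lemma ell2_le f (J : {fset I}) : \sum_(i <- J) rnorm (f i) ^+ 2 <= ell2_nsq f.
Proof. by rewrite -lee_fin -ell2_nsqE -sumEFin; exact: fset_le_esum. Qed.

Lemma cvg_ell2_re f g :
  (fun J : {fset I} => \sum_(i <- J) rc_re (inner (f i) (g i))) @ @totally I -->
  (ell2_nsq (f + g) - ell2_nsq f - ell2_nsq g) / 2.
Proof.
have h : (fun J : {fset I} => (\sum_(i <- J) rnorm ((f + g) i) ^+ 2 - \sum_(i <- J) rnorm (f i) ^+ 2
      - \sum_(i <- J) rnorm (g i) ^+ 2) / 2) @ @totally I -->
  (ell2_nsq (f + g) - ell2_nsq f - ell2_nsq g) / 2.
  by apply: cvgMr_tmp; apply: cvgB; [apply: cvgB|]; exact: cvg_ell2_nsq.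
apply: cvg_trans h; apply: near_eq_cvg; near=> J.
rewrite /= -!sumrB mulr_suml; apply: eq_bigr => i _.
by rewrite rnormD2; field.
Unshelve. all: by end_near. Qed.

Lemma ell2_inner_cvg f g :
  (fun J : {fset I} => \sum_(i <- J) inner (f i) (g i) : K^o) @ @totally I -->
    (ell2_inner f g : K^o).
Proof.
have [j jP] := rc_unit K.
have h f' g' : (fun J : {fset I} => rc_of K (\sum_(i <- J) rc_re (inner (f' i) (g' i))) : K^o)
    @ @totally I -->
    (rc_of K ((ell2_nsq (f' + g') - ell2_nsq f' - ell2_nsq g') / 2) : K^o).
  by apply: cvg_rc_of; exact: cvg_ell2_re.
have h1 := h f g; have h2 := cvgMr_tmp (b := j) (h f (j *: g)).
have {}h2 := h2 (@filter_filter _ _ (totally_filter I)).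
have h3 := @cvgD _ _ _ _ (@filter_filter _ _ (totally_filter I)) _ _ _ _ h1 h2.
have -> : ell2_inner f g = lim ((fun J : {fset I} => \sum_(i <- J) inner (f i) (g i) : K^o) @ @totally I) by [].
apply/cvg_ex.
match type of h3 with _ --> ?l => exists l end.
apply: cvg_trans h3; apply: near_eq_cvg; near=> J.
transitivity (rc_of K (\sum_(i <- J) rc_re (inner (f i) (g i))) +
  rc_of K (\sum_(i <- J) rc_re (inner (f i) (ell2_fun (j *: g) i))) * j) => //.
rewrite !(rmorph_sum (rc_of K)) mulr_suml -big_split/=.
apply: eq_bigr => i _.
rewrite [RHS]jP. congr (_ + rc_of K (rc_re _) * _).
by rewrite linearZr_LR mulrC.
Unshelve. all: by end_near. Qed.

Lemma ell2_inner_lim f g l :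
  (fun J : {fset I} => \sum_(i <- J) inner (f i) (g i) : K^o) @ @totally I --> (l : K^o) ->
  ell2_inner f g = l.
Proof. by move=> h; apply: cvg_lim h; exact: norm_hausdorff. Qed.

Lemma ell2_inner_zmodl g : zmod_morphism (ell2_inner ^~ g).
Proof.
move=> f f'; apply: ell2_inner_lim.
have h : (fun J : {fset I} => \sum_(i <- J) inner (f i) (g i) -
    \sum_(i <- J) inner (f' i) (g i) : K^o) @ @totally I -->
    (ell2_inner f g - ell2_inner f' g : K^o).
  by apply: cvgB; exact: ell2_inner_cvg.
apply: cvg_trans h; apply: near_eq_cvg; near=> J.
by rewrite -sumrB; apply: eq_bigr => i _; rewrite -linearBl.
Unshelve. all: by end_near. Qed.

Lemma ell2_inner_scalel g : scalable_for *%R (ell2_inner ^~ g).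
Proof.
move=> a f; apply: ell2_inner_lim.
have h : (fun J : {fset I} => a * \sum_(i <- J) inner (f i) (g i) : K^o)
    @ @totally I --> (a * ell2_inner f g : K^o).
  by apply: cvgMl_tmp; exact: ell2_inner_cvg.
apply: cvg_trans h; apply: near_eq_cvg; near=> J.
rewrite mulr_sumr; apply: eq_bigr => i _.
by rewrite linearZl_LR.
Unshelve. all: by end_near. Qed.

Lemma ell2_inner_herm f g :
  ell2_inner f g = (-1) ^+ false * rc_conj K (ell2_inner g f).
Proof.
rewrite expr0 mul1r; apply: ell2_inner_lim.
have h : (fun J : {fset I} => rc_conj K (\sum_(i <- J) inner (g i) (f i)) : K^o)
    @ @totally I --> (rc_conj K (ell2_inner g f) : K^o).
  have h := @ell2_inner_cvg g f.
  move/cvgrPdist_lt : h => /= h.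
  apply/cvgrPdist_lt => /= e e0; near=> J.
  rewrite -rmorphB/= rc_norm_conj; near: J; exact: h.
apply: cvg_trans h; apply: near_eq_cvg; near=> J.
by rewrite rmorph_sum/=; apply: eq_bigr => i _; rewrite -inner_conj.
Unshelve. all: by end_near. Qed.

Lemma ell2_innerxx f : ell2_inner f f = rc_of K (ell2_nsq f).
Proof.
apply: ell2_inner_lim.
have h : (fun J : {fset I} => rc_of K (\sum_(i <- J) rnorm (f i) ^+ 2) : K^o)
    @ @totally I --> (rc_of K (ell2_nsq f) : K^o).
  by apply: cvg_rc_of; exact: cvg_ell2_nsq.
apply: cvg_trans h; apply: near_eq_cvg; near=> J.
by rewrite rmorph_sum; apply: eq_bigr => i _; rewrite rc_innerxx.
Unshelve. all: by end_near. Qed.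

Lemma ell2_nsq_eq0 f : ell2_nsq f = 0 -> f = 0.
Proof.
move=> f0; apply: ell2_ext => i; rewrite ell20.
have := ell2_le f [fset i]%fset; rewrite f0 big_seq_fset1 => fi.
have /eqP : rnorm (f i) ^+ 2 = 0 by apply/eqP; rewrite eq_le fi sqr_ge0.
rewrite expf_eq0/= => /eqP r0; apply/eqP; rewrite -normr_eq0.
by rewrite -rnormE r0 rmorph0.
Qed.

Lemma ell2_nsq_ge0 f : 0 <= ell2_nsq f.
Proof. by apply: le_trans (ell2_le f fset0); rewrite big_nil. Qed.

Lemma ell2_inner_gt0 f : f != 0 -> 0 < ell2_inner f f.
Proof.
move=> f0; rewrite ell2_innerxx rc_of_gt0 lt_neqAle ell2_nsq_ge0 andbT eq_sym.
by apply: contraNN f0 => /eqP/ell2_nsq_eq0 ->.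
Qed.

Lemma ell2_inner_zmodr f : zmod_morphism (ell2_inner f).
Proof.
move=> g g'; rewrite !(ell2_inner_herm f) !expr0 !mul1r.
by rewrite ell2_inner_zmodl rmorphB.
Qed.

Lemma ell2_inner_scaler f :
  scalable_for (rc_conj K \; *%R) (ell2_inner f).
Proof.
move=> a g; rewrite !(ell2_inner_herm f) !expr0 !mul1r.
by rewrite ell2_inner_scalel rmorphM.
Qed.

HB.instance Definition _ := @isBilinear.Build K E E K *%R (rc_conj K \; *%R)
  ell2_inner ell2_inner_zmodl ell2_inner_zmodr ell2_inner_scalel ell2_inner_scaler.
HB.instance Definition _ := @isHermitianSesquilinear.Build K E false
  (rc_conj K) ell2_inner ell2_inner_herm.
HB.instance Definition _ := isDotProduct.Build K E ell2_inner ell2_inner_gt0.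

End ell2_inner_def.

Section ell2_norm_def.
Variables (R : realType) (K : rclike R) (H : hilbertType K) (I : choiceType).
Variable U : I -> closed_subspace H.
Local Notation E := (ell2 U).
Implicit Types f g h : E.

Definition ell2_norm f : K := rc_of K (Num.sqrt (ell2_nsq f)).

Lemma ell2_nsqZ a f : ell2_nsq (a *: f) = rc_re `|a| ^+ 2 * ell2_nsq f.
Proof.
apply: (@rc_of_inj _ K); rewrite rmorphM rmorphXn/= -!ell2_innerxx.
rewrite ell2_inner_scalel ell2_inner_scaler/= mulrA rc_mul_conj.
by rewrite rc_re_real// ger0_real.
Qed.

Lemma ell2_nsqD f g :
  ell2_nsq (f + g) = ell2_nsq f + ell2_nsq g + rc_re (ell2_inner f g) *+ 2.
Proof.
apply: (@rc_of_inj _ K).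
rewrite rmorphD/= rmorphMn/= rmorphD/= -!ell2_innerxx.
rewrite (linearDl (@ell2_inner R K H I U : {dot E for rc_conj K})).
rewrite !(linearDr (@ell2_inner R K H I U : {dot E for rc_conj K}))/=.
rewrite -rc_add_conj -(mul1r (rc_conj K _)) -(expr0 (-1)).
by rewrite -[_ ^+ 0 * _](ell2_inner_herm g f); ring.
Qed.

Lemma ell2_CS f g :
  rc_re (ell2_inner f g) <= Num.sqrt (ell2_nsq f) * Num.sqrt (ell2_nsq g).
Proof.
set a := Num.sqrt (ell2_nsq f); set b := Num.sqrt (ell2_nsq g).
have aE : ell2_nsq f = a ^+ 2 by rewrite sqr_sqrtr ?ell2_nsq_ge0.
have bE : ell2_nsq g = b ^+ 2 by rewrite sqr_sqrtr ?ell2_nsq_ge0.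
have re0 : rc_re (0 : K) = 0 by rewrite -(rmorph0 (rc_of K)) rc_ofK.
have [a0|a0] := eqVneq a 0.
  have -> : f = 0 by apply: ell2_nsq_eq0; rewrite aE a0 expr0n.
  rewrite (linear0l (@ell2_inner R K H I U : {dot E for rc_conj K})) re0.
  by rewrite mulr_ge0 ?sqrtr_ge0.
have [b0|b0] := eqVneq b 0.
  have -> : g = 0 by apply: ell2_nsq_eq0; rewrite bE b0 expr0n.
  rewrite (linear0r (@ell2_inner R K H I U : {dot E for rc_conj K})) re0.
  by rewrite mulr_ge0 ?sqrtr_ge0.
have ap : 0 < a by rewrite lt_neqAle eq_sym a0 sqrtr_ge0.
have bp : 0 < b by rewrite lt_neqAle eq_sym b0 sqrtr_ge0.
have := ell2_nsq_ge0 (rc_of K b *: f + rc_of K (- a) *: g).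
rewrite ell2_nsqD !ell2_nsqZ !rc_norm_of !rc_ofK !real_normK ?num_real//.
rewrite ell2_inner_scalel ell2_inner_scaler/= rc_conj_of !rc_reZ aE bE.
set r := rc_re _ => h.
have : 0 <= (a * b) * (a * b - r) *+ 2 by apply: le_trans h _; rewrite le_eqVlt; apply/orP; left; apply/eqP; ring.
by rewrite pmulrn_lge0// pmulr_rge0 ?mulr_gt0// subr_ge0.
Qed.

Lemma ell2_normD f g : ell2_norm (f + g) <= ell2_norm f + ell2_norm g.
Proof.
rewrite -rmorphD rc_of_le.
rewrite -(@ler_pXn2r _ 2)// ?nnegrE ?addr_ge0 ?sqrtr_ge0//.
rewrite sqrrD !sqr_sqrtr ?ell2_nsq_ge0// ell2_nsqD addrAC lerD2r lerD2l lerMn2r/=.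
exact: ell2_CS.
Qed.

Lemma ell2_normZ (a : K) f : ell2_norm (a *: f) = `|a| * ell2_norm f.
Proof.
have a0 : 0 <= rc_re `|a| by rewrite -(rc_of_ge0 K) rc_re_real// ger0_real.
rewrite /ell2_norm ell2_nsqZ sqrtrM ?sqr_ge0// sqrtr_sqr ger0_norm//.
by rewrite rmorphM/= rc_re_real// ger0_real.
Qed.

Lemma ell2_norm_eq0 f : ell2_norm f = 0 -> f = 0.
Proof.
move=> /eqP; rewrite fmorph_eq0 sqrtr_eq0 => f0; apply: ell2_nsq_eq0.
by apply/eqP; rewrite eq_le f0 ell2_nsq_ge0.
Qed.

HB.instance Definition _ :=
  Lmodule_isNormed.Build K E ell2_normD ell2_normZ ell2_norm_eq0.

Lemma ell2_rnorm f : rnorm f = Num.sqrt (ell2_nsq f).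
Proof. by rewrite /rnorm rc_ofK. Qed.

Lemma ell2_nsq_rnorm f : ell2_nsq f = rnorm f ^+ 2.
Proof. by rewrite ell2_rnorm sqr_sqrtr ?ell2_nsq_ge0. Qed.

Lemma ell2_le_rnorm f i : rnorm (f i) <= rnorm f.
Proof.
rewrite -(@ler_pXn2r _ 2)// ?nnegrE ?rnorm_ge0// -ell2_nsq_rnorm.
by have := ell2_le f [fset i]%fset; rewrite big_seq_fset1.
Qed.

Lemma ell2_complete (F : set_system E) : ProperFilter F -> cauchy F -> cvg F.
Proof.
move=> FF Fc.
have Fex e : 0 < e -> exists f0 : E, F (ball f0 e).
  by move: Fc => /cauchyP /(_ e); apply.
have coord_norm f i : `|f i| <= `|f|.
  by rewrite -!rnormE rc_of_le ell2_le_rnorm.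
have coordc i : cvg ((fun f : E => f i) @ F).
  apply: cauchy_cvg; apply: cauchy_exP => e /Fex[f0 f0e]; exists (f0 i).
  suff : ball f0 e `<=` (fun f : E => f i) @^-1` ball (f0 i) e.
    by move=> /filterS; apply.
  move=> f; rewrite /preimage/= -!ball_normE/=.
  by apply: le_lt_trans; exact: (coord_norm (f0 - f) i).
pose g i := lim ((fun f : E => f i) @ F).
have gc i : (fun f : E => f i) @ F --> g i by exact: coordc.
have gU i : cs_set (U i) (g i).
  refine (@closed_cvg _ _ F FF (fun f : E => f i) (cs_set (U i)) (@cs_closed _ _ _ (U i)) _ _ (gc i)).
  by apply: nearW => f; exact: ell2U.
have key (e : R) : 0 < e -> \forall f \near F, forall J : {fset I},
    \sum_(i <- J) rnorm (@ell2_fun _ _ _ _ U f i - g i) ^+ 2 <= e ^+ 2.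
  move=> e0; have [|f0 f0e] := Fex (rc_of K (e / 2)).
    by rewrite rc_of_gt0 divr_gt0.
  have nearfh (f h : E) : ball f0 (rc_of K (e / 2)) f ->
      ball f0 (rc_of K (e / 2)) h -> rnorm (f - h) <= e.
    rewrite -!ball_normE/= -!rnormE !rc_of_lt => fe he.
    rewrite -(subrKA f0) addrC; apply: (le_trans (rnormD _ _)).
    rewrite [leRHS]splitr lerD ?ltW//.
    by rewrite -(rc_of_lt K) !rnormE distrC -rnormE rc_of_lt.
  near=> f => J.
  have fe : ball f0 (rc_of K (e / 2)) f by near: f.
  have h : (fun h : E => \sum_(i <- J) rnorm (f i - h i) ^+ 2) @ F -->
      \sum_(i <- J) rnorm (f i - g i) ^+ 2.
    apply: cvg_big => [|i _]; first exact: add_continuous.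
    have h1 : (fun h : E => rnorm (f i - h i)) @ F --> rnorm (f i - g i).
      by apply: cvg_rnorm; apply: cvgB; [exact: cvg_cst|exact: gc].
    exact: (cvgM h1 h1).
  apply: (cvgr_to_le h); near=> h'.
  apply: le_trans (ell2_le (f - h') J) _.
  rewrite ell2_nsq_rnorm lerXn2r ?nnegrE ?rnorm_ge0 ?(ltW e0)//.
  by apply: nearfh => //; near: h'.
have [f /= fk] := filter_ex (key 1 ltr01).
have dP : (fun i => f i - g i) \in ell2_pred U.
  apply/asboolP; split => [i|].
    rewrite addrC -scaleN1r; apply: cs_lin; [exact: gU|exact: ell2U].
  by apply: le_lt_trans (ltry 1); apply: esum_le_fset => J; rewrite -(expr1n R 2).
pose gE : E := f - Ell2 dP.
have gEi i : gE i = g i.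
  transitivity (f i - (f i - g i)) => //.
  by rewrite opprB addrC subrK.
apply/cvg_ex; exists gE; apply/cvgrPdist_le => e e0.
have ee : rc_of K (rc_re e) = e by rewrite rc_re_real// gtr0_real.
have re0 : 0 < rc_re e by rewrite -(rc_of_gt0 K) ee.
have := key _ re0; apply: filterS => h hk.
rewrite distrC -rnormE -ee rc_of_le.
rewrite -(@ler_pXn2r _ 2)// ?nnegrE ?rnorm_ge0 ?(ltW re0)//.
rewrite -ell2_nsq_rnorm -lee_fin -ell2_nsqE; apply: esum_le_fset => J.
apply: le_trans (hk J); rewrite le_eqVlt; apply/orP; left; apply/eqP.
apply: eq_bigr => i _; rewrite -gEi; congr (rnorm _ ^+ 2).
Unshelve. all: by end_near. Qed.

HB.instance Definition _ := Uniform_isComplete.Build E ell2_complete.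

Lemma ell2_inner_norm f :
  (@ell2_inner R K H I U : {dot E for rc_conj K}) f f = `|f| ^+ 2.
Proof.
by rewrite /= ell2_innerxx ell2_nsq_rnorm rmorphXn/= rnormE.
Qed.

HB.instance Definition _ := isHilbert.Build R K E ell2_inner_norm.
End ell2_norm_def.

Section operators.
Variables (R : realType) (K : rclike R).
Implicit Types X Y : hilbertType K.

Definition bounded_op X Y (T : X -> Y) := linear T /\ continuous T.

Definition compact_op X Y (T : X -> Y) :=
  linear T /\ forall B : set X, bounded_set B -> precompact (T @` B).

(* For bounded T the Riesz representation theorem provides, for each y, exactly
   one x in the set below. *)
Definition adjoint X Y (T : X -> Y) : Y -> X := fun y =>
  xget 0 [set x | forall z, inner (T z) y = inner z x].

(* Self-adjointness is not implied by the last clause over the reals. *)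
Definition positive_op X (A : X -> X) :=
  [/\ bounded_op A, forall x y, inner (A x) y = inner x (A y)
    & forall x, 0 <= inner (A x) x].

(* the unique positive square root of a positive operator *)
Definition op_sqrt X (A : X -> X) : X -> X :=
  xget (fun=> 0) [set Q | positive_op Q /\ Q \o Q = A].

(* the inverse of a bijective A *)
Definition op_inv X (A : X -> X) : X -> X := 'pinv_(fun=> 0) [set: X] A.

Definition eigenspace_op X (A : X -> X) (a : K) : set X :=
  [set x | A x = a *: x].

Definition has_dim X (E : set X) (n : nat) := exists b : 'I_n -> X,
  (forall c : 'I_n -> K, \sum_i c i *: b i = 0 -> forall i, c i = 0) /\
  E = [set x | exists c : 'I_n -> K, x = \sum_i c i *: b i].

(* s lists the positive square roots of the eigenvalues of T^* T in
   nonincreasing order, each repeated according to its multiplicity, and is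
   followed by zeros if there are only finitely many of them. *)
Definition singular_values X Y (T : X -> Y) (s : nat -> R) :=
  [/\ nonincreasing_seq s, forall n, 0 <= s n &
    forall mu : R, 0 < mu -> exists m : nat,
      ([set k | s k = mu] #= `I_m)%card /\
      has_dim (eigenspace_op (adjoint T \o T) (rc_of K (mu ^+ 2))) m].

Definition schatten X Y (p : R) (T : X -> Y) :=
  compact_op T /\ exists s : nat -> R, singular_values T s /\
    (\sum_(0 <= n <oo) (s n `^ p)%:E < +oo)%E.

(* the orthogonal projection onto U *)
Definition orth_proj X (U : closed_subspace X) (x : X) : X :=
  xget 0 [set y | cs_set U y /\ forall u, cs_set U u -> inner (x - y) u = 0].

End operators.

Section fusion.
Variables (R : realType) (K : rclike R) (H : hilbertType K) (I : choiceType).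

Record weighted_family := WeightedFamily {
  wf_space : I -> closed_subspace H;
  wf_weight : I -> R;
  wf_weight_gt0 : forall i, 0 < wf_weight i }.

Implicit Types W V : weighted_family.

Definition fusion_energy W (f : H) : \bar R :=
  (\esum_(i in [set: I])
    (wf_weight W i ^+ 2 * rnorm (orth_proj (wf_space W i) f) ^+ 2)%:E)%E.

Definition bessel_fusion W := exists B : R,
  forall f : H, (fusion_energy W f <= (B * rnorm f ^+ 2)%:E)%E.

Definition fusion_frame W := bessel_fusion W /\ exists2 A : R, 0 < A &
  forall f : H, ((A * rnorm f ^+ 2)%:E <= fusion_energy W f)%E.

Definition synthesis W (f : ell2 (wf_space W)) : H :=
  usum (fun i => rc_of K (wf_weight W i) *: f i).

Definition frame_op W : H -> H := @synthesis W \o adjoint (@synthesis W).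

Definition frame_matrix W V (O : H -> H) :
    ell2 (wf_space V) -> ell2 (wf_space W) :=
  adjoint (@synthesis W) \o O \o @synthesis V.

Definition frame_matrix_tensor W V (O : H -> H) :
    ell2 (wf_space V) -> ell2 (wf_space W) :=
  adjoint (@synthesis W) \o op_inv (op_sqrt (frame_op W)) \o O
    \o op_inv (op_sqrt (frame_op V)) \o @synthesis V.

End fusion.

Arguments synthesis {R K H I} W f.
Arguments frame_op {R K H I} W f.
Arguments frame_matrix {R K H I} W V O f.
Arguments frame_matrix_tensor {R K H I} W V O f.

(* Main.v *)
From HB Require Import structures.
Require Import Defs.
From mathcomp Require Import all_boot all_order all_algebra finmap.
From mathcomp Require Import ring lra.
From mathcomp Require Import boolp classical_sets functions cardinality.
From mathcomp Require Import reals ereal normedtype sequences esum exp.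

Set Implicit Arguments.
Unset Strict Implicit.
Unset Printing Implicit Defensive.

Import Order.TTheory GRing.Theory Num.Theory.
Import numFieldNormedType.Exports.

Local Open Scope classical_set_scope.
Local Open Scope ring_scope.

(** Write C for the analysis operator f |-> (w_i pi_i f)_i, and T for the
    synthesis operator.  A Bessel bound makes C bounded, and T = C^* because the
    two agree on finitely supported families and the sums defining T converge
    through such families ([synthesisE], [adjoint_synthesis]).  Hence the matrix of O is the product
    C_W O T_V of bounded operators with O in the middle, and the first two
    claims say that compact operators, and Schatten operators, form ideals.

    For compact operators this holds because bounded operators preserve bounded
    sets and precompact sets ([compact_op_comp]).  For Schatten operators
    ([schatten_comp]) the singular values of A T B have to be produced and
    compared with those of T.  A compact T has a singular system: the norm of T
    on a closed subspace invariant under T^* T is attained at an eigenvector of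
    T^* T, by compactness, and one may go on in its orthogonal complement
    ([exists_max_eigenvector], [exists_singular_system]).  The numbers obtained
    are the singular values of T ([singular_system_values]), which are
    determined by the multiplicities of the eigenvalues
    ([singular_values_unique]).  If e'_0, ..., e'_n are the first right singular
    vectors of A T B and e_0, ..., e_(n-1) those of T, a count of dimensions
    gives a nonzero x in the span of the former with B x orthogonal to the
    latter, so that
      s_n(A T B) |x| <= |A T B x| <= |A| s_n(T) |B x| <= |A| s_n(T) |B| |x|
    ([singular_system_comp_le]), and summability of s_n(T)^p carries over.

    For fusion frames S = T C is symmetric and bounded below, hence invertible
    ([coercive_inverse]), by a Neumann series.  So C_W has the left inverse
    S_W^-1 T_W and T_V the right inverse C_V S_V^-1, and O is recovered from its
    matrix by multiplication with bounded operators on both sides.  The matrix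
    C_W S_W^(-1/2) O S_V^(-1/2) T_V is of the same kind, since S has a positive
    square root ([exists_op_sqrt]), and every square root Q of S has the
    bounded inverse Q S^-1 ([op_inv_sqrtP]). *)

(** * Inner products and norms with values in the reals *)

Section hilbert_basics.
Variables (R : realType) (K : rclike R).

Definition rabs (z : K) : R := rc_re `|z|.

Lemma rc_of_rabs z : rc_of K (rabs z) = `|z|.
Proof. by rewrite /rabs rc_re_real// ger0_real. Qed.

Lemma rabs_ge0 z : 0 <= rabs z.
Proof. by rewrite -(rc_of_ge0 K) rc_of_rabs. Qed.

Lemma rabs_of r : rabs (rc_of K r) = `|r|.
Proof. by rewrite /rabs rc_norm_of rc_ofK. Qed.

Lemma rabsM z w : rabs (z * w) = rabs z * rabs w.
Proof.
by apply: (@rc_of_inj _ K); rewrite rmorphM/= !rc_of_rabs normrM.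
Qed.

Lemma rabs_conj z : rabs (rc_conj K z) = rabs z.
Proof. by rewrite /rabs rc_norm_conj. Qed.

Lemma rabs_eq0 z : rabs z = 0 -> z = 0.
Proof.
move=> z0; apply/eqP; rewrite -normr_eq0; apply/eqP.
by rewrite -rc_of_rabs z0 rmorph0.
Qed.

Lemma rabs_sqr z : rc_of K (rabs z ^+ 2) = z * rc_conj K z.
Proof. by rewrite rc_mul_conj rmorphXn/= rc_of_rabs. Qed.

Lemma re_conj_mul z : rc_re (rc_conj K z * z) = rabs z ^+ 2.
Proof. by rewrite mulrC -rabs_sqr rc_ofK. Qed.

Lemma rc_re0 : rc_re (0 : K) = 0.
Proof. by rewrite -(rmorph0 (rc_of K)) rc_ofK. Qed.

Lemma rc_reN (z : K) : rc_re (- z) = - rc_re z.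
Proof.
by apply/eqP; rewrite -subr_eq0 opprK -rc_reD addNr rc_re0.
Qed.

Lemma rc_reB (z w : K) : rc_re (z - w) = rc_re z - rc_re w.
Proof. by rewrite rc_reD rc_reN. Qed.

Variable X : hilbertType K.
Implicit Types (x y z : X) (a : K) (r : R).

Lemma innerDl x y z : inner (x + y) z = inner x z + inner y z.
Proof. exact: linearDl. Qed.
Lemma innerBl x y z : inner (x - y) z = inner x z - inner y z.
Proof. exact: linearBl. Qed.
Lemma innerDr x y z : inner x (y + z) = inner x y + inner x z.
Proof. exact: linearDr. Qed.
Lemma innerBr x y z : inner x (y - z) = inner x y - inner x z.
Proof. exact: linearBr. Qed.
Lemma innerZl a x y : inner (a *: x) y = a * inner x y.
Proof. exact: linearZl_LR. Qed.
Lemma innerZr a x y : inner x (a *: y) = rc_conj K a * inner x y.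
Proof. exact: linearZr_LR. Qed.
Lemma inner0l x : inner 0 x = 0 :> K.
Proof. exact: linear0l. Qed.
Lemma inner0r x : inner x 0 = 0 :> K.
Proof. exact: linear0r. Qed.
Lemma inner_suml I (r : seq I) (P : pred I) (f : I -> X) y :
  inner (\sum_(i <- r | P i) f i) y = \sum_(i <- r | P i) inner (f i) y.
Proof. by rewrite linear_sumlz. Qed.
Lemma inner_sumr I (r : seq I) (P : pred I) (f : I -> X) y :
  inner y (\sum_(i <- r | P i) f i) = \sum_(i <- r | P i) inner y (f i).
Proof. by rewrite linear_sum. Qed.

Lemma inner_eq0C x y : inner x y = 0 -> inner y x = 0.
Proof. by move=> xy; rewrite inner_conj xy rmorph0. Qed.

Lemma re_innerC x y : rc_re (inner x y) = rc_re (inner y x) :> R.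
Proof. by rewrite inner_conj rc_re_conj. Qed.

Lemma re_innerxx x : rc_re (inner x x) = rnorm x ^+ 2.
Proof. by rewrite -rc_innerxx rc_ofK. Qed.

Lemma rnorm_eq0 x : rnorm x = 0 -> x = 0.
Proof.
move=> x0; apply/eqP; rewrite -normr_eq0; apply/eqP.
by rewrite -rnormE x0 rmorph0.
Qed.

Lemma rnorm_gt0 x : x != 0 -> 0 < rnorm x.
Proof.
move=> x0; rewrite lt_neqAle rnorm_ge0 andbT eq_sym.
by apply: contraNN x0 => /eqP/rnorm_eq0 ->.
Qed.

Lemma rnormZr r x : rnorm (rc_of K r *: x) = `|r| * rnorm x.
Proof. by rewrite rnormZ -/(rabs _) rabs_of. Qed.

Lemma rnormN x : rnorm (- x) = rnorm x.
Proof. by apply: (@rc_of_inj _ K); rewrite !rnormE normrN. Qed.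

Lemma rnormBC x y : rnorm (x - y) = rnorm (y - x).
Proof. by rewrite -rnormN opprB. Qed.

Lemma rnormB_le x y : rnorm (x - y) <= rnorm x + rnorm y.
Proof. by rewrite -[leRHS]/(rnorm x + _) -(rnormN y); exact: rnormD. Qed.

Lemma rnormB2 x y :
  rnorm (x - y) ^+ 2 = rnorm x ^+ 2 + rnorm y ^+ 2 - rc_re (inner x y) *+ 2.
Proof.
by rewrite rnormD2 rnormN -scaleN1r innerZr rmorphN rmorph1 mulN1r rc_reN mulNrn.
Qed.

Lemma inner_ext x y : (forall z, inner z x = inner z y) -> x = y.
Proof.
move=> xy; apply/eqP; rewrite -subr_eq0; apply/eqP/rnorm_eq0.
by apply/eqP; rewrite -sqrf_eq0 -re_innerxx innerBr xy subrr rc_re0.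
Qed.

Lemma le_of_sqr (a b : R) : 0 <= b -> a ^+ 2 <= b ^+ 2 -> a <= b.
Proof.
move=> b0 ab; case: (lerP a 0) => [a0|/ltW a0]; first exact: le_trans b0.
by move: ab; rewrite ler_pXn2r// nnegrE.
Qed.

(** The Cauchy-Schwarz inequality: the squared norm of |x|^2 y - Re <x, y> x
    is nonnegative. *)
Lemma re_inner_le x y : rc_re (inner x y) <= rnorm x * rnorm y.
Proof.
apply: le_of_sqr; first by rewrite mulr_ge0// rnorm_ge0.
have [->|x0] := eqVneq x 0; first by rewrite inner0l rc_re0 rnorm0 mul0r.
have n0 : 0 < rnorm x ^+ 2 by rewrite exprn_gt0// rnorm_gt0.
set c := rc_re (inner x y).
have := sqr_ge0 (rnorm (rc_of K (rnorm x ^+ 2) *: y - rc_of K c *: x)).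
rewrite rnormB2 !rnormZr innerZl innerZr rc_conj_of !rc_reZ (re_innerC y).
rewrite -/c !exprMn !real_normK ?num_real// => h.
have {h} : 0 <= rnorm x ^+ 2 * (rnorm x ^+ 2 * rnorm y ^+ 2 - c ^+ 2).
  by apply: le_trans h _; rewrite le_eqVlt; apply/orP; left; apply/eqP; ring.
by rewrite pmulr_rge0// subr_ge0.
Qed.

(** Replacing x by a multiple makes <x, y> real and nonnegative. *)
Lemma rabs_inner_le x y : rabs (inner x y) <= rnorm x * rnorm y.
Proof.
have [->|n0] := eqVneq (rabs (inner x y)) 0.
  by rewrite mulr_ge0 ?rnorm_ge0.
have np : 0 < rabs (inner x y) by rewrite lt_neqAle eq_sym n0 rabs_ge0.
rewrite -(ler_pM2l np) -expr2 -re_conj_mul -innerZl.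
by apply: le_trans (re_inner_le _ _) _; rewrite rnormZ -/(rabs _) rabs_conj mulrA.
Qed.

(** * Convergence and completeness *)

Lemma cvg_rnormP (T : Type) (F : set_system T) (FF : Filter F)
    (f : T -> X) (l : X) :
  f @ F --> l <-> forall e : R, 0 < e -> \forall t \near F, rnorm (l - f t) < e.
Proof.
split => [/cvgrPdist_lt fl e e0|fl].
  have := fl (rc_of K e); rewrite rc_of_gt0 => /(_ e0).
  by apply: filterS => t; rewrite -rnormE rc_of_lt.
apply/cvgrPdist_lt => e e0.
have ee : rc_of K (rc_re e) = e by rewrite rc_re_real// gtr0_real.
have := fl (rc_re e); rewrite -(rc_of_gt0 K) ee => /(_ e0).
by apply: filterS => t; rewrite -rnormE -{2}ee rc_of_lt.
Qed.

Lemma cauchy_filter_cvg (F : set_system X) (FF : ProperFilter F) :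
  (forall e : R, 0 < e -> exists x, F [set y | rnorm (x - y) < e]) ->
  exists l : X, F --> l.
Proof.
move=> Fc; suff : cvg F by move=> /cvg_ex.
apply: cauchy_cvg; apply: cauchy_exP => e e0.
have ee : rc_of K (rc_re e) = e by rewrite rc_re_real// gtr0_real.
have := Fc (rc_re e); rewrite -(rc_of_gt0 K) ee => /(_ e0) [x Fx].
exists x; apply: filterS Fx => y /=.
by rewrite -ball_normE/= -rnormE -{2}ee rc_of_lt.
Qed.

Lemma geometric_cvg (u : nat -> X) (C q : R) : 0 <= q -> q < 1 ->
  (forall n, rnorm (u n.+1 - u n) <= C * q ^+ n) ->
  exists l : X, u @ \oo --> l.
Proof.
move=> q0 q1 uq; apply: cauchy_filter_cvg => e e0.
have q1' : 0 < 1 - q by rewrite subr_gt0.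
have C0 : 0 <= C by have := uq 0; rewrite expr0 mulr1; apply: le_trans; exact: rnorm_ge0.
have dist N k : rnorm (u (N + k)%N - u N) * (1 - q) <= C * q ^+ N * (1 - q ^+ k).
  elim: k => [|k IH]; first by rewrite addn0 subrr rnorm0 mul0r expr0 subrr mulr0.
  rewrite addnS -(subrKA (u (N + k)%N)).
  apply: le_trans (ler_wpM2r (ltW q1') (rnormD _ _)) _.
  rewrite mulrDl; apply: le_trans (lerD (ler_wpM2r (ltW q1') (uq _)) IH) _.
  by rewrite exprD exprSr le_eqVlt; apply/orP; left; apply/eqP; ring.
have /cvgrPdist_lt/(_ (e * (1 - q))) : (fun n => C * q ^+ n) @ \oo --> (0 : R).
  by apply: cvg_geometric; rewrite ger0_norm.
rewrite mulr_gt0// => /(_ isT)[N _ NC]; exists (u N); exists N => // n /= Nn.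
rewrite rnormBC -(ltr_pM2r q1').
have := NC N (leqnn _); rewrite /= sub0r normrN ger0_norm ?mulr_ge0 ?exprn_ge0//.
apply: le_lt_trans; rewrite -(subnKC Nn); apply: le_trans (dist _ _) _.
by rewrite ler_piMr ?mulr_ge0 ?exprn_ge0// lerBlDr lerDl exprn_ge0.
Qed.

Lemma cvg_inner (T : Type) (F : set_system T) (FF : Filter F)
    (f : T -> X) (l y : X) :
  f @ F --> l -> (fun t => inner (f t) y : K^o) @ F --> (inner l y : K^o).
Proof.
move=> /cvg_rnormP fl; apply/cvgrPdist_lt => e e0.
have ee : rc_of K (rc_re e) = e by rewrite rc_re_real// gtr0_real.
have n0 : 0 < rnorm y + 1 by rewrite ltr_wpDl ?rnorm_ge0.
have := fl (rc_re e / (rnorm y + 1)).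
rewrite divr_gt0 ?n0// -?(rc_of_gt0 K) ?ee// => /(_ isT).
apply: filterS => t; rewrite ltr_pdivlMr// => h.
rewrite -innerBl -rc_of_rabs -ee rc_of_lt; apply: le_lt_trans h.
apply: le_trans (rabs_inner_le _ _) _.
by rewrite ler_wpM2l ?rnorm_ge0// lerDl.
Qed.

(** * Orthogonal projection and the Riesz representation theorem *)

Implicit Type U : closed_subspace X.

Lemma csD U x y : cs_set U x -> cs_set U y -> cs_set U (x + y).
Proof. by move=> Ux Uy; rewrite -(scale1r x); exact: cs_lin. Qed.

Lemma csZ U a x : cs_set U x -> cs_set U (a *: x).
Proof. by move=> Ux; rewrite -(addr0 (_ *: _)); apply: cs_lin => //; exact: cs_zero. Qed.

Lemma csB U x y : cs_set U x -> cs_set U y -> cs_set U (x - y).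
Proof. by move=> Ux Uy; rewrite addrC -scaleN1r; exact: cs_lin. Qed.

(** A minimising filter for the distance to U is Cauchy, by the
    parallelogram identity. *)
Lemma closest_point U x : exists2 y, cs_set U y &
  forall u, cs_set U u -> rnorm (x - y) ^+ 2 <= rnorm (x - u) ^+ 2.
Proof.
pose D := [set rnorm (x - u) ^+ 2 | u in cs_set U].
have D0 : has_inf D.
  split; first by exists (rnorm (x - 0) ^+ 2), 0 => //; exact: cs_zero.
  by exists 0 => _ [u _ <-]; exact: sqr_ge0.
pose d := inf D.
have dD u : cs_set U u -> d <= rnorm (x - u) ^+ 2.
  by move=> Uu; apply: ge_inf; [exact: D0.2|exists u].
pose B (e : R) := [set u | cs_set U u /\ rnorm (x - u) ^+ 2 < d + e].
have Bdist e u v : B e u -> B e v -> rnorm (u - v) ^+ 2 <= 4 * e.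
  move=> [Uu ue] [Uv ve].
  have Um : cs_set U ((2^-1 : K) *: (u + v)) by apply: csZ; exact: csD.
  have := dD _ Um; set w := _ *: _ => dw.
  have e1 : u - v = (x - v) - (x - u) by rewrite opprB [RHS]addrC addrA subrK.
  have e2 : rc_of K 2 *: (x - w) = (x - v) + (x - u).
    rewrite scalerBr /w scalerA rmorph_nat mulfV ?pnatr_eq0// scale1r.
    by rewrite scaler_nat mulr2n opprD addrACA [LHS]addrC.
  have := congr1 (fun t => rnorm t ^+ 2) e2; rewrite /= rnormZr exprMn.
  rewrite rnormD2 real_normK ?num_real// => e3.
  rewrite e1 rnormB2.
  by move: e3 dw ue ve; lra.
pose F := filter_from [set e : R | 0 < e] B.
have FF : ProperFilter F.
  apply: filter_from_proper; first apply: filter_from_filter.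
  - by exists 1 => /=.
  - move=> e f /= e0 f0; exists (Num.min e f); first by rewrite /= lt_min e0.
    move=> u [Uu ue]; split; split => //; apply: lt_le_trans ue _;
    by rewrite lerD2l ge_min lexx ?orbT.
  - move=> e e0; have [_ [u Uu <-] ue] := inf_adherent e0 D0.
    by exists u; split.
have [|y Fy] := @cauchy_filter_cvg F FF.
  move=> e e0; have e20 : 0 < (e / 2) ^+ 2 / 4 by rewrite !(divr_gt0, exprn_gt0).
  have [_ [u Uu <-] ue] := inf_adherent e20 D0.
  exists u; exists ((e / 2) ^+ 2 / 4) => // v /= Bv.
  apply: (@le_lt_trans _ _ (e / 2)); last by rewrite ltr_pdivrMr// ltr_pMr// ltr1n.
  apply: le_of_sqr; first by rewrite divr_ge0// ltW.
  by rewrite (le_trans (Bdist _ _ _ (conj Uu ue) Bv))// mulrC divfK.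
exists y.
  apply: (@closed_cvg _ _ F _ id (cs_set U)) Fy; first exact: cs_closed.
  by exists 1 => //= u [].
move=> u Uu; apply: le_trans (dD u Uu).
have /cvg_rnorm : (fun t => x - t) @ F --> x - y by apply: cvgB => //; exact: cvg_cst.
move=> h; rewrite expr2.
have {}h : (fun t => rnorm (x - t) * rnorm (x - t)) @ F -->
    rnorm (x - y) * rnorm (x - y) by exact: (cvgM h h).
apply/ler_addgt0Pr => e e0; apply: (cvgr_to_le h).
by exists e => // v [_ /ltW]; rewrite expr2.
Qed.

(** A closest point of U is the foot of the perpendicular from x. *)
Lemma orth_projP U x :
  cs_set U (orth_proj U x) /\
  forall u, cs_set U u -> inner (x - orth_proj U x) u = 0.
Proof.
suff [y yP] : exists y, cs_set U y /\ forall u, cs_set U u -> inner (x - y) u = 0.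
  by rewrite /orth_proj; case: xgetP => [z _//|] /(_ y)/(_ yP).
have [y Uy ymin] := closest_point U x; exists y; split=> // u Uu.
set c := inner (x - y) u; apply: rabs_eq0; apply/eqP; rewrite -sqrf_eq0.
(* Moving from y by t c in the direction u would otherwise reduce the distance
   for all small t > 0. *)
pose t := (rnorm u ^+ 2 + 1)^-1.
have n1 : 0 < rnorm u ^+ 2 + 1 by rewrite ltr_wpDl// sqr_ge0.
have t0 : 0 < t by rewrite invr_gt0.
have := ymin _ (csD Uy (csZ (rc_of K t * c) Uu)).
rewrite opprD addrA [in leRHS]rnormB2 rnormZ -/(rabs _) rabsM rabs_of gtr0_norm//.
rewrite innerZr -/c rmorphM/= rc_conj_of -(mulrA (rc_of K t)) rc_reZ re_conj_mul.
rewrite -addrA lerDl exprMn => h.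
have h2 : t * rnorm u ^+ 2 <= 1.
  by rewrite mulrC ler_pdivrMr// mul1r lerDl.
have {}h : 0 <= t * (rabs c ^+ 2 * (t * rnorm u ^+ 2 - 2)).
  by apply: le_trans h _; rewrite le_eqVlt; apply/orP; left; apply/eqP; ring.
rewrite pmulr_rge0// in h.
have c0 := sqr_ge0 (rabs c).
rewrite eq_le c0 andbT; move: h h2 c0; set s := rabs c ^+ 2; set v := t * _ => h h2 c0.
nra.
Qed.

Lemma orth_proj_unique U x y : cs_set U y ->
  (forall u, cs_set U u -> inner (x - y) u = 0) -> orth_proj U x = y.
Proof.
move=> Uy yP; have [Up pP] := orth_projP U x; set z := orth_proj U x in Up pP *.
apply/eqP; rewrite -subr_eq0; apply/eqP/rnorm_eq0/eqP; rewrite -sqrf_eq0.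
have Uzy : cs_set U (z - y) by exact: csB.
have e : z - y = (x - y) - (x - z) by rewrite opprB [RHS]addrC addrA subrK.
by rewrite -re_innerxx {1}e innerBl yP// pP// subrr rc_re0.
Qed.

(** The functional f is represented by a multiple of the component of a vector
    orthogonal to the kernel of f. *)
Lemma riesz (f : X -> K) (C : R) :
  (forall a x y, f (a *: x + y) = a * f x + f y) ->
  (forall x, rabs (f x) <= C * rnorm x) ->
  exists y, forall x, f x = inner x y.
Proof.
move=> flin fC.
have fD x y : f (x + y) = f x + f y by rewrite -{1}(scale1r x) flin mul1r.
have f0 : f 0 = 0 by apply: (addrI (f 0)); rewrite -fD !addr0.
have fZ a x : f (a *: x) = a * f x by rewrite -(addr0 (_ *: _)) flin f0 addr0.
have fB x y : f (x - y) = f x - f y by rewrite addrC -scaleN1r flin mulN1r addrC.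
have kc : closed [set x | f x = 0].
  move=> x clx; apply: rabs_eq0; apply/eqP; rewrite eq_le rabs_ge0 andbT.
  apply/ler_addgt0Pr => e e0; rewrite add0r; have C0 : 0 < `|C| + 1 by rewrite ltr_wpDl.
  have [|y [/= fy xy]] := clx [set y | rnorm (x - y) < e / (`|C| + 1)].
    have /cvg_rnormP := @cvg_id X (nbhs x); apply.
    by rewrite divr_gt0.
  rewrite ltr_pdivlMr// in xy.
  rewrite -(subr0 (f x)) -fy -fB (le_trans (fC _))// (le_trans _ (ltW xy))//.
  rewrite mulrC ler_wpM2l ?rnorm_ge0// (le_trans (ler_norm C))// lerDl//.
pose U := @ClosedSubspace R K X [set x | f x = 0] kc f0
  (fun a x y fx fy => etrans (flin a x y)
    (etrans (congr2 +%R (etrans (congr1 _ fx) (mulr0 a)) fy) (addr0 0))).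
have [|] := pselect (exists x, f x != 0); last first.
  move=> nx; exists 0 => x; rewrite inner0r.
  by apply/eqP; apply: contra_notT nx => ?; exists x.
move=> [x fx0]; have [Up pP] := orth_projP U x.
set w := x - orth_proj U x in pP.
have fw : f w = f x by rewrite fB [f (orth_proj _ _)]Up subr0.
have w0 : w != 0.
  by apply: contraNneq fx0 => we; rewrite -fw we f0.
have ww : inner w w != 0.
  by rewrite -rc_innerxx fmorph_eq0 sqrf_eq0 gt_eqF// rnorm_gt0.
exists (rc_conj K (f w / inner w w) *: w) => y.
have /pP/inner_eq0C : cs_set U (f w *: y - f y *: w).
  by rewrite /= fB !fZ mulrC subrr.
rewrite innerBl !innerZl => /eqP; rewrite subr_eq0 => /eqP e.
by rewrite innerZr rc_conjK mulrAC e mulfK.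
Qed.

End hilbert_basics.

(** * Bounded operators and their adjoints *)

Section operators.
Variables (R : realType) (K : rclike R).
Implicit Types X Y Z V : hilbertType K.

Section linear_theory.
Variables (X Y : lmodType K) (T : X -> Y) (Tlin : linear T).

Lemma linop0 : T 0 = 0.
Proof.
by have := Tlin (-1) 0 0; rewrite !scaleN1r oppr0 addr0 addNr.
Qed.

Lemma linopD x y : T (x + y) = T x + T y.
Proof. by have := Tlin 1 x y; rewrite !scale1r. Qed.

Lemma linopZ a x : T (a *: x) = a *: T x.
Proof. by have := Tlin a x 0; rewrite linop0 !addr0. Qed.

Lemma linopB x y : T (x - y) = T x - T y.
Proof. by rewrite linopD -scaleN1r linopZ scaleN1r. Qed.

Lemma linop_sum I (r : seq I) (P : pred I) (f : I -> X) :
  T (\sum_(i <- r | P i) f i) = \sum_(i <- r | P i) T (f i).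
Proof. exact: (big_morph T linopD linop0). Qed.

End linear_theory.

Lemma linop_comp (X Y Z : lmodType K) (A : Y -> Z) (B : X -> Y) :
  linear A -> linear B -> linear (A \o B).
Proof. by move=> Al Bl a x y /=; rewrite Bl Al. Qed.

Lemma bounded_opP X Y (T : X -> Y) : bounded_op T <->
  linear T /\ exists2 M : R, 0 < M & forall x, rnorm (T x) <= M * rnorm x.
Proof.
split=> [[Tl Tc]|[Tl [M M0 TM]]]; split=> //.
  have /cvg_rnormP/(_ _ ltr01) := Tc 0; rewrite (linop0 Tl).
  move=> /nbhs_ballP[e /= e0 Te].
  have ee : rc_of K (rc_re e) = e by rewrite rc_re_real// gtr0_real.
  have d0 : 0 < rc_re e by rewrite -(rc_of_gt0 K) ee.
  have {}Te x : rnorm x < rc_re e -> rnorm (T x) < 1.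
    move=> xe; rewrite -rnormN -sub0r; apply: Te.
    by rewrite -ball_normE/= sub0r normrN -ee -rnormE rc_of_lt.
  exists (2 / rc_re e) => [|x]; first by rewrite divr_gt0.
  have [->|x0] := eqVneq x 0; first by rewrite (linop0 Tl) !rnorm0 mulr0.
  have n0 := rnorm_gt0 x0.
  have := Te (rc_of K (rc_re e / 2 / rnorm x) *: x).
  have c0 : 0 < rc_re e / 2 / rnorm x by rewrite !divr_gt0.
  rewrite (linopZ Tl) !rnormZr gtr0_norm// divfK ?gt_eqF//.
  rewrite ltr_pdivrMr// ltr_pMr// ltr1n => /(_ isT) /ltW.
  move=> h; rewrite -(ler_pM2l c0) (le_trans h)//; set r := _ * (_ * _).
  suff -> : r = 1 by [].
  by rewrite /r; field; rewrite !gt_eqF.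
move=> x; apply/cvg_rnormP => e e0.
have /cvg_rnormP/(_ (e / M)) : y @[y --> nbhs x] --> x by exact: cvg_id.
rewrite divr_gt0// => /(_ isT); apply: filterS => y.
by rewrite -(linopB Tl) ltr_pdivlMr// mulrC; exact: le_lt_trans.
Qed.

Lemma bounded_op_comp X Y Z (A : Y -> Z) (B : X -> Y) :
  bounded_op A -> bounded_op B -> bounded_op (A \o B).
Proof.
move=> /bounded_opP[Al [M M0 AM]] /bounded_opP[Bl [N N0 BN]]; apply/bounded_opP.
split; first exact: linop_comp.
exists (M * N) => [|x /=]; first exact: mulr_gt0.
by rewrite (le_trans (AM _))// -mulrA ler_pM2l.
Qed.

Section adjoint.
Variables (X Y : hilbertType K) (T : X -> Y) (Tb : bounded_op T).

Lemma adjointP x y : inner (T x) y = inner x (adjoint T y).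
Proof.
suff [w wP] : exists w, forall z, inner (T z) y = inner z w.
  by rewrite /adjoint; case: xgetP => [z _ -> //|] /(_ w)/(_ wP).
have [Tl [M M0 TM]] := (bounded_opP T).1 Tb.
apply: (@riesz _ _ _ _ (rnorm y * M)) => [a u v|u].
  by rewrite Tl innerDl innerZl.
rewrite (le_trans (rabs_inner_le _ _))// mulrC -mulrA.
by rewrite ler_wpM2l ?rnorm_ge0.
Qed.

Lemma adjoint_unique (S : Y -> X) :
  (forall x y, inner (T x) y = inner x (S y)) -> adjoint T = S.
Proof.
by move=> TS; apply/funext => y; apply: inner_ext => x; rewrite -adjointP.
Qed.

Lemma adjoint_linear : linear (adjoint T).
Proof.
move=> a x y; apply: inner_ext => z.
by rewrite innerDr innerZr -!adjointP innerDr innerZr.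
Qed.

Lemma adjoint_bounded : bounded_op (adjoint T).
Proof.
have [Tl [M M0 TM]] := (bounded_opP T).1 Tb.
apply/bounded_opP; split; first exact: adjoint_linear.
exists M => // y; have [->|y0] := eqVneq (adjoint T y) 0.
  by rewrite rnorm0 mulr_ge0 ?rnorm_ge0 ?ltW.
rewrite -(ler_pM2l (rnorm_gt0 y0)) -expr2 -re_innerxx -adjointP.
rewrite (le_trans (re_inner_le _ _))// mulrA ler_wpM2r ?rnorm_ge0//.
by rewrite [leRHS]mulrC.
Qed.

End adjoint.

(** * Compact operators *)

Lemma bounded_setP X (B : set X) : bounded_set B <->
  exists M : R, forall x, B x -> rnorm x <= M.
Proof.
split=> [/ex_strict_bound_gt0[M M0 BM]|[M BM]].
  exists (rc_re M) => x Bx; have /= := BM _ Bx.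
  by rewrite -(rc_of_le K) rnormE rc_re_real ?gtr0_real// => /ltW.
exists (rc_of K M); split=> [|N MN x Bx /=].
  have [M0|/ltW M0] := lerP 0 M; first by rewrite ger0_real// rc_of_ge0.
  by rewrite ler0_real// -oppr_ge0 -rmorphN rc_of_ge0 oppr_ge0.
by rewrite (le_trans _ (ltW MN))// -rnormE rc_of_le; exact: BM.
Qed.

(** A continuous map sends precompact sets to precompact sets because the
    space is Hausdorff. *)
Lemma compact_op_comp X Y Z V (A : Z -> V) (T : Y -> Z) (B : X -> Y) :
  bounded_op A -> bounded_op B -> compact_op T -> compact_op (A \o T \o B).
Proof.
move=> [Al Ac] /bounded_opP[Bl [M M0 BM]] [Tl Tc]; split.
  by apply: linop_comp => //; exact: linop_comp.
move=> S /bounded_setP[N SN].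
have /Tc : bounded_set (B @` S).
  apply/bounded_setP; exists (M * N) => _ [x Sx <-].
  by rewrite (le_trans (BM _))// ler_pM2l//; exact: SN.
rewrite precompactE => cTB.
have : precompact (A @` closure (T @` (B @` S))).
  apply: compact_precompact; first exact: norm_hausdorff.
  by apply: continuous_compact => //; exact: continuous_subspaceT.
apply: precompact_subset => _ [x Sx <-] /=.
by exists (T (B x)) => //; apply: subset_closure; exists (B x) => //; exists x.
Qed.

Lemma ultra_fmap (S S' : Type) (f : S -> S') (F : set_system S) :
  UltraFilter F -> UltraFilter (f @ F).
Proof.
move=> FU; have FP : ProperFilter F by exact: ultra_proper.
split; first exact: fmap_proper_filter.
move=> G GP FG; rewrite predeqE => A; split; last exact: FG.
move=> GA; have [//|FnA] := in_ultra_setVsetC (f @^-1` A) FU.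
have GnA : G (~` A) by exact: FG.
by have [x []] := filter_ex (filterI GA GnA).
Qed.

(** Passing to an ultrafilter replaces the extraction of a subsequence. *)
Lemma compact_op_ultra X Y (T : X -> Y) (F : set_system X) (M : R) :
  compact_op T -> ProperFilter F -> F [set x | rnorm x <= M] ->
  exists2 G : set_system X, UltraFilter G & F `<=` G /\
    exists y : Y, T t @[t --> G] --> y.
Proof.
move=> [_ Tc] FF FM; have [G [GU FG]] := ultraFilterLemma FF; exists G => //.
split=> //; have /Tc : bounded_set [set x : X | rnorm x <= M].
  by apply/bounded_setP; exists M.
rewrite precompactE compact_ultra => /(_ (T @ G)) [||y [_ Gy]].
- exact: ultra_fmap.
- suff : G (T @^-1` closure (T @` [set x | rnorm x <= M])) by [].
  by apply: filterS (FG _ FM) => x xM; apply: subset_closure; exists x.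
- by exists y.
Qed.

End operators.

(** * Singular systems of compact operators *)

Section singular_system.
Variables (R : realType) (K : rclike R).

(** A Schmidt decomposition without the left singular vectors.  Where s
    vanishes, e may vanish too, so that spaces of finite dimension are covered
    by infinite sequences. *)
Record singular_system (X Y : hilbertType K) (T : X -> Y)
    (e : nat -> X) (s : nat -> R) : Prop := SingularSystem {
  ss_noninc : nonincreasing_seq s;
  ss_ge0 : forall n, 0 <= s n;
  ss_orth : forall i j, i != j -> inner (e i) (e j) = 0;
  ss_norm : forall n, 0 < s n -> rnorm (e n) = 1;
  ss_eigen : forall n, adjoint T (T (e n)) = rc_of K (s n ^+ 2) *: e n;
  ss_max : forall n x, (forall i, (i < n)%N -> inner x (e i) = 0) ->
    rnorm (T x) <= s n * rnorm x;
  ss_lt : forall mu : R, 0 < mu -> exists n, s n < mu }.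

Lemma closed_inner_eq0 (X : hilbertType K) (x : X) :
  closed [set y | inner y x = 0].
Proof.
apply: (@closed_comp _ K^o (fun y => inner y x) [set 0]).
  by move=> y _; apply: cvg_inner; exact: cvg_id.
by apply: accessible_closed_set1; apply: hausdorff_accessible; exact: norm_hausdorff.
Qed.

Section perp.
Variables (X : hilbertType K) (M : closed_subspace X) (x : X).

Let perp_set := [set y | cs_set M y /\ inner y x = 0].

Let perp_closed : closed perp_set.
Proof. by apply: closedI; [exact: cs_closed|exact: closed_inner_eq0]. Qed.

Let perp0 : perp_set 0.
Proof. by split; [exact: cs_zero|exact: inner0l]. Qed.

Let perp_lin (a : K) u v : perp_set u -> perp_set v -> perp_set (a *: u + v).
Proof.
move=> [Mu ux] [Mv vx]; split; first exact: cs_lin.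
by rewrite innerDl innerZl ux vx mulr0 addr0.
Qed.

Definition perp := ClosedSubspace perp_closed perp0 perp_lin.

End perp.

Definition full_subspace (X : hilbertType K) : closed_subspace X :=
  @ClosedSubspace _ _ _ [set: X] (@closedT X) I (fun _ _ _ _ _ => I).

Variables (X Y : hilbertType K) (T : X -> Y).
Hypotheses (Tb : bounded_op T) (Tc : compact_op T).

Local Notation A x := (adjoint T (T x)).

Lemma inner_adjoint_comp x y : inner (A x) y = inner (T x) (T y).
Proof. by rewrite [LHS]inner_conj -adjointP// -inner_conj. Qed.

Lemma adjoint_comp_sym x y : inner (A x) y = inner x (A y).
Proof. by rewrite inner_adjoint_comp adjointP. Qed.

Lemma rnorm_op2 x : rnorm (T x) ^+ 2 = rc_re (inner (A x) x).
Proof. by rewrite inner_adjoint_comp re_innerxx. Qed.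

Let Tl : linear T. Proof. by case: Tb. Qed.

(** The norm of T on an invariant subspace M is attained at an eigenvector:
    the inequality near_eigen shows that maximising sequences consist of
    approximate eigenvectors of T^* T, and compactness makes them converge. *)
Lemma exists_max_eigenvector (M : closed_subspace X) :
  (forall x, cs_set M x -> cs_set M (A x)) ->
  exists p : X * R, [/\ cs_set M p.1, 0 <= p.2, 0 < p.2 -> rnorm p.1 = 1,
    A p.1 = rc_of K (p.2 ^+ 2) *: p.1 &
    forall y, cs_set M y -> rnorm (T y) <= p.2 * rnorm y].
Proof.
move=> MA; have [_ [C C0 TC]] := (bounded_opP T).1 Tb.
pose D := [set rnorm (T x) | x in [set x | cs_set M x /\ rnorm x <= 1]].
have D0 : D 0.
  exists 0; last by rewrite (linop0 Tl) rnorm0.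
  by split; [exact: cs_zero|rewrite rnorm0].
have Dsup : has_sup D.
  split; first by exists 0.
  exists C => _ [x [_ x1] <-]; rewrite (le_trans (TC _))//.
  by rewrite ler_piMr// ltW.
pose s := sup D.
have s_ge0 : 0 <= s by apply: ub_le_sup => //; exact: Dsup.2.
have sM y : cs_set M y -> rnorm (T y) <= s * rnorm y.
  move=> My; have [->|y0] := eqVneq y 0; first by rewrite (linop0 Tl) !rnorm0 mulr0.
  have n0 := rnorm_gt0 y0; rewrite -ler_pdivrMr//.
  apply: ub_le_sup; first exact: Dsup.2.
  exists (rc_of K (rnorm y)^-1 *: y); last first.
    by rewrite (linopZ Tl) rnormZr gtr0_norm ?invr_gt0// mulrC.
  split; first exact: csZ.
  by rewrite rnormZr gtr0_norm ?invr_gt0// mulVf// gt_eqF.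
have [s0|s_neq0] := eqVneq s 0.
  exists (0, 0); split => //=.
  - exact: cs_zero.
  - by rewrite ltxx.
  - by rewrite scaler0 (linop0 Tl) (linop0 (adjoint_linear Tb)).
  - by move=> y My; rewrite -s0; exact: sM.
have s_gt0 : 0 < s by rewrite lt_neqAle eq_sym s_neq0.
have AM x : cs_set M x -> rnorm (A x) <= s * rnorm (T x).
  move=> Mx; have [->|Ax0] := eqVneq (A x) 0.
    by rewrite rnorm0 mulr_ge0 ?rnorm_ge0.
  rewrite -(ler_pM2r (rnorm_gt0 Ax0)) -expr2 -re_innerxx inner_adjoint_comp.
  rewrite (le_trans (re_inner_le _ _))// mulrAC mulrC ler_wpM2r ?rnorm_ge0//.
  exact/sM/MA.
have near_eigen x : cs_set M x -> rnorm x <= 1 ->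
    rnorm (A x - rc_of K (s ^+ 2) *: x) ^+ 2 <= s ^+ 2 * (s ^+ 2 - rnorm (T x) ^+ 2).
  move=> Mx x1; rewrite rnormB2 innerZr rc_conj_of rc_reZ -rnorm_op2.
  rewrite rnormZr ger0_norm ?sqr_ge0//.
  have h1 : rnorm (A x) ^+ 2 <= s ^+ 2 * rnorm (T x) ^+ 2.
    rewrite -exprMn ler_pXn2r// ?nnegrE ?mulr_ge0 ?rnorm_ge0//; exact: AM.
  have h2 : (s ^+ 2 * rnorm x) ^+ 2 <= s ^+ 2 * s ^+ 2.
    rewrite -expr2 ler_pXn2r// ?nnegrE ?mulr_ge0 ?rnorm_ge0 ?sqr_ge0//.
    by rewrite ler_piMr ?sqr_ge0.
  by move: h1 h2; set a := rnorm (A x) ^+ 2; lra.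
pose B (e : R) := [set x | [/\ cs_set M x, rnorm x <= 1 & s - e < rnorm (T x)]].
pose F := filter_from [set e : R | 0 < e] B.
have FF : ProperFilter F.
  apply: filter_from_proper; first apply: filter_from_filter.
  - by exists 1 => /=.
  - move=> e f /= e0 f0; exists (Num.min e f); first by rewrite /= lt_min e0.
    move=> x [Mx x1 xe]; split; split => //; apply: le_lt_trans xe;
    by rewrite lerD2l lerN2 ge_min lexx ?orbT.
  - move=> e e0; have [_ [x [Mx x1] <-] xe] := sup_adherent e0 Dsup.
    by exists x; split.
have F1 : F [set x | rnorm x <= 1] by exists 1 => //= x [].
have [G GU [FG [y Gy]]] := compact_op_ultra Tc FF F1.
have GP : ProperFilter G by exact: ultra_proper.
have [_ Tcont] := Tb; have [_ Acont] := adjoint_bounded Tb.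
have h1 : (fun t => A t) @ G --> adjoint T y.
  exact: cvg_comp Gy (Acont y).
have h2 : (fun t => A t - rc_of K (s ^+ 2) *: t) @ G --> (0 : X).
  apply/cvg_rnormP => e e0; apply: FG.
  exists (e ^+ 2 / (s ^+ 2 * (2 * s))) => [|x [Mx x1 xe]] /=.
    by rewrite divr_gt0 ?mulr_gt0 ?exprn_gt0.
  rewrite sub0r rnormN -(@ltr_pXn2r _ 2)// ?nnegrE ?rnorm_ge0 ?ltW//.
  apply: le_lt_trans (near_eigen _ Mx x1) _.
  have xs : rnorm (T x) <= s.
    by rewrite (le_trans (sM _ Mx))// ler_piMr.
  rewrite -ltr_pdivlMl ?exprn_gt0// mulrC.
  move: xe; rewrite invfM mulrA; set d := e ^+ 2 / _ => xe.
  have Tx0 := rnorm_ge0 (T x).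
  have : (s - rnorm (T x)) * (2 * s) < d.
    by rewrite -ltr_pdivlMr ?mulr_gt0//; move: xe; lra.
  move: xs Tx0 s_gt0; set a := rnorm (T x); clear; nra.
pose x := rc_of K (s ^+ 2)^-1 *: adjoint T y.
have Gx : G --> x.
  have h3 : (fun t => A t - (A t - rc_of K (s ^+ 2) *: t)) @ G --> adjoint T y - 0.
    exact: cvgB.
  have h4 : (fun t => rc_of K (s ^+ 2)^-1 *: (A t - (A t - rc_of K (s ^+ 2) *: t)))
      @ G --> x by rewrite /x -[adjoint T y]subr0; exact: cvgZl_tmp h3.
  suff E : (fun t => rc_of K (s ^+ 2)^-1 *: (A t - (A t - rc_of K (s ^+ 2) *: t)))
      = id by move: h4; rewrite E.
  apply/funext => t; rewrite opprB addrC subrK scalerA -rmorphM mulVf ?rmorph1.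
    by rewrite scale1r.
  by rewrite expf_neq0.
have GB e : 0 < e -> G (B e) by move=> e0; apply: FG; exists e.
have Mx : cs_set M x.
  apply: (@closed_cvg _ _ G _ id (cs_set M)) Gx; first exact: cs_closed.
  by apply: filterS (GB 1 ltr01) => t [].
have x1 : rnorm x <= 1.
  have h : (fun t => rnorm t) @ G --> rnorm x by exact: cvg_rnorm.
  apply: (cvgr_to_le h).
  by apply: filterS (GB 1 ltr01) => t [].
have sx : s <= rnorm (T x).
  have h : (fun t => T t) @ G --> T x by exact: cvg_comp Gx (Tcont x).
  have {}h : (fun t => rnorm (T t)) @ G --> rnorm (T x) by exact: cvg_rnorm.
  apply/ler_addgt0Pr => e e0; rewrite -lerBlDr; apply: (cvgr_to_ge h).
  by apply: filterS (GB e e0) => t [_ _ /ltW].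
exists (x, s); split => //=.
- move=> _; apply/eqP; rewrite eq_le x1/=.
  by rewrite -(ler_pM2l s_gt0) mulr1 (le_trans sx)//; exact: sM.
- apply/eqP; rewrite -subr_eq0; apply/eqP/rnorm_eq0/eqP; rewrite -sqrf_eq0.
  rewrite eq_le sqr_ge0 andbT (le_trans (near_eigen _ Mx x1))//.
  rewrite pmulr_rle0 ?exprn_gt0// subr_le0 ler_pXn2r// nnegrE ?rnorm_ge0//.
Qed.

(** Maximising eigenvectors are split off one after the other; the vectors
    orthogonal to those already found form an invariant subspace M n. *)
Lemma exists_singular_system : exists e s, singular_system T e s.
Proof.
pose inv (M : closed_subspace X) := forall x, cs_set M x -> cs_set M (A x).
have /choice[F FP] : forall M : closed_subspace X, exists p : X * R, inv M ->
    [/\ cs_set M p.1, 0 <= p.2, 0 < p.2 -> rnorm p.1 = 1,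
      A p.1 = rc_of K (p.2 ^+ 2) *: p.1 &
      forall y, cs_set M y -> rnorm (T y) <= p.2 * rnorm y].
  move=> M; have [/exists_max_eigenvector[p pP]|ninv] := pselect (inv M).
    by exists p.
  by exists (0, 0).
pose M n := iter n (fun M => perp M (F M).1) (full_subspace X).
pose e n := (F (M n)).1; pose s n := (F (M n)).2.
have Minv n : inv (M n).
  elim: n => [|n IH] x //= [Mx xe]; split; first exact: IH.
  have [_ _ _ Ae _] := FP _ IH.
  by rewrite adjoint_comp_sym Ae innerZr -/(M n) xe mulr0.
have MP n x : cs_set (M n) x <-> forall i, (i < n)%N -> inner x (e i) = 0.
  elim: n => [|n IH] //=; split=> [[/IH Mx xe] i|xe].
    by rewrite ltnS leq_eqVlt => /predU1P[->//|]; exact: Mx.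
  by split; [apply/IH => i /ltnW/xe|exact: xe].
have Fn n := FP _ (Minv n).
have s_ge0 n : 0 <= s n by case: (Fn n).
have e_norm n : 0 < s n -> rnorm (e n) = 1 by case: (Fn n).
have e_eigen n : A (e n) = rc_of K (s n ^+ 2) *: e n by case: (Fn n).
have s_max n x : (forall i, (i < n)%N -> inner x (e i) = 0) ->
    rnorm (T x) <= s n * rnorm x.
  by move=> /MP; case: (Fn n) => _ _ _ _; exact.
have eM n : cs_set (M n) (e n) by case: (Fn n).
have e_orth i j : i != j -> inner (e i) (e j) = 0.
  rewrite neq_ltn => /orP[ij|ji]; last exact: (MP _ _).1.
  by apply: inner_eq0C; exact: (MP _ _).1.
have Te n : rnorm (T (e n)) ^+ 2 = s n ^+ 2 * rnorm (e n) ^+ 2.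
  by rewrite rnorm_op2 e_eigen innerZl rc_reZ re_innerxx.
have s_noninc : nonincreasing_seq s.
  apply/nonincreasing_seqP => n.
  have [->//|sn0] := eqVneq (s n.+1) 0.
  have sn1 : 0 < s n.+1 by rewrite lt_neqAle eq_sym sn0 s_ge0.
  have := Te n.+1; rewrite e_norm// expr1n mulr1 => /eqP.
  rewrite eqrXn2 ?rnorm_ge0// => /eqP <-.
  rewrite -[leRHS]mulr1 -(e_norm _ sn1); apply: s_max => i ni.
  by apply: e_orth; rewrite gtn_eqF// ltnS ltnW.
exists e, s; split=> // mu mu0.
(* Otherwise the T (e n) are orthogonal and of norm at least mu, hence at
   distance more than mu from each other, although they accumulate somewhere. *)
apply: contrapT => /forallNP h.
have {}h n : mu <= s n by rewrite leNgt; apply/negP; exact: h.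
have s_gt0 n : 0 < s n by exact: lt_le_trans (h n).
have [|G GU [FG [y Gy]]] := @compact_op_ultra _ _ _ _ T (e @ \oo) 1 Tc _.
  by exists 0%N => // n _ /=; rewrite e_norm.
have GP : ProperFilter G by exact: ultra_proper.
have mu2 : 0 < mu / 2 by rewrite divr_gt0.
have /cvg_rnormP/(_ _ mu2) Gmu := Gy.
have Gge N : G [set e n | n in [set n | (N <= n)%N]].
  by apply: FG; exists N => // n /= Nn; exists n.
have [t1 [/= Te1 [i _ ei]]] := filter_ex (filterI Gmu (Gge 0%N)); subst.
have [t2 [/= Te2 [j /= ij ej]]] := filter_ex (filterI Gmu (Gge i.+1)); subst.
have : rnorm (T (e i) - T (e j)) < mu.
  rewrite -(subrKA y) [ltRHS]splitr; apply: le_lt_trans (rnormD _ _) _.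
  by rewrite rnormBC ltrD.
rewrite -(@ltr_pXn2r _ 2)// ?nnegrE ?rnorm_ge0 ?ltW//.
rewrite rnormB2 -inner_adjoint_comp e_eigen innerZl e_orth ?ltn_eqF// mulr0 rc_re0.
rewrite mul0rn subr0 !Te !e_norm// expr1n !mulr1.
have : mu ^+ 2 <= s i ^+ 2 by rewrite ler_pXn2r// nnegrE ltW.
by have := sqr_ge0 (s j); lra.
Qed.

End singular_system.

(** * Singular values *)

Section singular_values.
Variables (R : realType) (K : rclike R).

Lemma exists_row_kernel (F : fieldType) (m n : nat) (M : 'I_m -> 'I_n -> F) :
  (n < m)%N ->
  exists2 c : 'I_m -> F, exists i, c i != 0 & forall j, \sum_i c i * M i j = 0.
Proof.
move=> nm; pose N := \matrix_(i, j) M i j.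
have /rowV0Pn[v /sub_kermxP vN v0] : kermx N != 0.
  rewrite -mxrank_eq0 mxrank_ker subn_eq0 -ltnNge.
  exact: leq_ltn_trans (rank_leq_col N) nm.
exists (v 0) => [|j]; first by apply/rV0Pn.
have := congr1 (fun A : 'rV_n => A 0 j) vN; rewrite !mxE => e.
by rewrite -[RHS]e; apply: eq_bigr => i _; rewrite mxE.
Qed.

Lemma has_dim_le (X : hilbertType K) (E : set X) (m n : nat) :
  has_dim E m -> has_dim E n -> (m <= n)%N.
Proof.
move=> [b [bfree bE]] [d [_ dE]]; rewrite leqNgt; apply/negP => nm.
have /choice[M bM] : forall i, exists c : 'I_n -> K, b i = \sum_j c j *: d j.
  move=> i; have : E (b i).
    rewrite bE; exists (fun j => (i == j)%:R).
    rewrite (bigD1 i)//= eqxx scale1r big1 ?addr0// => j.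
    by rewrite eq_sym => /negbTE ->; rewrite scale0r.
  by rewrite dE.
have [c [i ci] cM] := exists_row_kernel M nm.
suff /bfree/(_ i)/eqP : \sum_i c i *: b i = 0 by rewrite (negbTE ci).
under eq_bigr => k _ do rewrite bM scaler_sumr.
rewrite exchange_big/= big1// => j _.
under eq_bigr => k _ do rewrite scalerA.
by rewrite -scaler_suml cM scale0r.
Qed.

(** For each mu > 0 the two sequences take the value mu equally often, so the
    indices k with t k > s n inject into those with s k > s n. *)
Lemma singular_values_le (X Y : hilbertType K) (T : X -> Y) (s t : nat -> R) :
  singular_values T s -> singular_values T t -> forall n, t n <= s n.
Proof.
move=> [s_ni s_ge0 sT] [t_ni t_ge0 tT] n; rewrite leNgt; apply/negP => st.
have /choice[F FP] : forall v : R, exists f : nat -> nat, 0 < v ->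
    (forall k, t k = v -> s (f k) = v) /\
    {in [set k | t k = v] &, injective f}.
  move=> v; have [v0|v0] := boolP (0 < v); last by exists id.
  have [m [sm Em]] := sT v v0; have [m' [tm Em']] := tT v v0.
  have mm' : m = m'.
    by apply/eqP; rewrite eqn_leq (has_dim_le Em Em') (has_dim_le Em' Em).
  have : ([set k | t k = v] #= [set k | s k = v])%card.
    by apply: card_eq_trans tm _; rewrite -mm' card_eq_sym.
  rewrite card_eq_le => /andP[/pcard_leP[f] _]; exists f => _; split; last exact: inj.
  by move=> k tk; have := @funS _ _ _ _ f k tk.
have t0 k : (k <= n)%N -> 0 < t k.
  by move=> kn; rewrite (le_lt_trans (s_ge0 n))// (lt_le_trans st)//; exact: t_ni.
pose f k := F (t k) k.
have sf k : (k <= n)%N -> s (f k) = t k by move=> kn; exact: (FP _ (t0 _ kn)).1.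
have fn k : (k <= n)%N -> (f k < n)%N.
  move=> kn; rewrite ltnNge; apply/negP => /s_ni; rewrite sf// => tks.
  by have := lt_le_trans st (le_trans (t_ni _ _ kn) tks); rewrite ltxx.
pose g (k : 'I_n.+1) : 'I_n := Ordinal (fn k (ltn_ord k)).
suff /leq_card : injective g by rewrite !card_ord ltnn.
move=> k l /(congr1 val) /= fkl; apply/val_inj => /=.
have kn : (k <= n)%N := ltn_ord k; have ln : (l <= n)%N := ltn_ord l.
have tkl : t k = t l by rewrite -sf// -sf// fkl.
apply: (FP _ (t0 _ ln)).2; rewrite ?inE//=.
by move: fkl; rewrite /f tkl.
Qed.

Lemma singular_values_unique (X Y : hilbertType K) (T : X -> Y) (s t : nat -> R) :
  singular_values T s -> singular_values T t -> s = t.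
Proof.
move=> sT tT; apply/funext => n; apply/eqP; rewrite eq_le.
by rewrite (singular_values_le sT tT) (singular_values_le tT sT).
Qed.

Section orthonormal_sums.
Variables (X : hilbertType K) (n : nat) (e : 'I_n -> X).
Hypothesis e_orth : forall i j, i != j -> inner (e i) (e j) = 0.
Hypothesis e_norm : forall i, rnorm (e i) = 1.

Lemma inner_orthonormal_sum (c : 'I_n -> K) j :
  inner (\sum_i c i *: e i) (e j) = c j.
Proof.
rewrite inner_suml (bigD1 j)//= big1 ?addr0 => [|i ij].
  by rewrite innerZl -rc_innerxx e_norm expr1n rmorph1 mulr1.
by rewrite innerZl e_orth// mulr0.
Qed.

Lemma re_inner_orthonormal_sums (c d : 'I_n -> K) :
  rc_re (inner (\sum_i d i *: e i) (\sum_i c i *: e i)) =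
  \sum_i rc_re (d i * rc_conj K (c i)).
Proof.
rewrite inner_suml; elim/big_ind2: _ => [|x a y b|i _]; first exact: rc_re0.
  by rewrite rc_reD => -> ->.
by rewrite innerZl (inner_conj (e i)) inner_orthonormal_sum.
Qed.

Lemma rnorm_orthonormal_sum (c : 'I_n -> K) :
  rnorm (\sum_i c i *: e i) ^+ 2 = \sum_i rabs (c i) ^+ 2.
Proof.
rewrite -re_innerxx re_inner_orthonormal_sums; apply: eq_bigr => i _.
by rewrite mulrC re_conj_mul.
Qed.

End orthonormal_sums.

Section singular_system_theory.
Variables (X Y : hilbertType K) (T : X -> Y) (Tb : bounded_op T).
Variables (e : nat -> X) (s : nat -> R) (es : singular_system T e s).

(** On the span of e 0, ..., e n, the operator T^* T is diagonal in an
    orthonormal basis, with diagonal entries at least (s n)^2. *)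
Lemma singular_system_lower n (c : 'I_n.+1 -> K) : 0 < s n ->
  s n * rnorm (\sum_i c i *: e i) <= rnorm (T (\sum_i c i *: e i)).
Proof.
move=> sn; have s_gt0 (i : 'I_n.+1) : 0 < s i.
  by rewrite (lt_le_trans sn)// (ss_noninc es)// -ltnS.
have e_norm (i : 'I_n.+1) : rnorm (e i) = 1 by exact: (ss_norm es).
have e_orth (i j : 'I_n.+1) : i != j -> inner (e i) (e j) = 0.
  by move=> ij; apply: (ss_orth es).
apply: le_of_sqr; first exact: rnorm_ge0.
rewrite rnorm_op2// (linop_sum Tb.1) (linop_sum (adjoint_linear Tb)).
have -> : \sum_i adjoint T (T (c i *: e i)) =
    \sum_i (c i * rc_of K (s i ^+ 2)) *: e i.
  apply: eq_bigr => i _; rewrite (linopZ Tb.1) (linopZ (adjoint_linear Tb)).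
  by rewrite (ss_eigen es) scalerA.
rewrite (re_inner_orthonormal_sums e_orth e_norm) exprMn.
rewrite (rnorm_orthonormal_sum e_orth e_norm) mulr_sumr; apply: ler_sum => i _.
have -> : c i * rc_of K (s i ^+ 2) * rc_conj K (c i) =
    rc_of K (s i ^+ 2) * (rc_conj K (c i) * c i) by ring.
rewrite rc_reZ re_conj_mul.
rewrite ler_wpM2r ?sqr_ge0//.
rewrite ler_pXn2r// ?nnegrE ?(ss_ge0 es)// (ss_noninc es)// -ltnS.
exact: ltn_ord.
Qed.

(** An eigenvector for mu^2 loses its components along the e k with s k = mu,
    and what remains is orthogonal to every e k with s k >= mu, so that the
    maximality of the first s c < mu makes it vanish. *)
Lemma singular_system_values : singular_values T s.
Proof.
split; [exact: (ss_noninc es)|exact: (ss_ge0 es)|] => mu mu0.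
have [N sN] := ss_lt es mu0.
(* The indices k with s k = mu form the interval from a to c - 1. *)
have exc : exists k, s k < mu by exists N.
have exa : exists k, s k <= mu by exists N; exact: ltW.
have [c sc cmin] := ex_minnP exc.
have [a sa amin] := ex_minnP exa.
have ac : (a <= c)%N by apply: amin; exact: ltW.
have lt_a k : (k < a)%N -> mu < s k.
  by move=> ka; rewrite ltNge; apply/negP => /amin; rewrite leqNgt ka.
have eq_s k : (a <= k < c)%N -> s k = mu.
  move=> /andP[ak kc]; apply/eqP; rewrite eq_le (le_trans (ss_noninc es ak) sa)/=.
  by rewrite leNgt; apply/negP => /cmin; rewrite leqNgt kc.
have s_eq k : s k = mu -> (a <= k < c)%N.
  move=> sk; apply/andP; split.
    by rewrite leqNgt; apply/negP => /lt_a; rewrite sk ltxx.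
  by rewrite ltnNge; apply/negP => /(ss_noninc es); rewrite sk leNgt sc.
exists (c - a)%N; split.
  have -> : [set k | s k = mu] = [set (a + i)%N | i in `I_(c - a)].
    apply/seteqP; split=> [k /s_eq/andP[ak kc]|_ [i /= ic <-]].
      by exists (k - a)%N; rewrite /= ?ltn_sub2r ?subnKC// (leq_ltn_trans ak).
    by apply: eq_s; rewrite leq_addr/= -ltn_subRL.
  by apply: inj_card_eq => i j _ _ /addnI.
pose b (i : 'I_(c - a)) := e (a + i)%N.
have b_s (i : 'I_(c - a)) : s (a + i)%N = mu.
  by apply: eq_s; rewrite leq_addr/= -ltn_subRL.
have b_norm i : rnorm (b i) = 1 by apply: (ss_norm es); rewrite b_s.
have b_orth i j : i != j -> inner (b i) (b j) = 0.
  by move=> ij; apply: (ss_orth es); rewrite eqn_add2l.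
have Al := adjoint_linear Tb; have Tl := Tb.1.
exists b; split=> [d d0 i|].
  by rewrite -(inner_orthonormal_sum b_orth b_norm d) d0 inner0l.
have sum_eigen d : adjoint T (T (\sum_i d i *: b i)) =
    rc_of K (mu ^+ 2) *: (\sum_i d i *: b i).
  rewrite (linop_sum Tl) (linop_sum Al) scaler_sumr; apply: eq_bigr => i _.
  by rewrite (linopZ Tl) (linopZ Al) (ss_eigen es) b_s !scalerA mulrC.
apply/seteqP; split=> [x /= Ax|_ [d ->]]; last exact: sum_eigen.
have {}Ax : adjoint T (T x) = rc_of K (mu ^+ 2) *: x by exact: Ax.
exists (fun i => inner x (b i)).
set z := \sum_i _; apply/eqP; rewrite -subr_eq0; apply/eqP.
have Ay : adjoint T (T (x - z)) = rc_of K (mu ^+ 2) *: (x - z).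
  by rewrite (linopB Tl) (linopB Al) Ax sum_eigen scalerBr.
have yc : rnorm (T (x - z)) <= s c * rnorm (x - z).
  apply: (ss_max es) => k kc; have [ak|ka] := leqP a k.
    have ki : (k - a < c - a)%N by rewrite ltn_sub2r// (leq_ltn_trans ak).
    have -> : e k = b (Ordinal ki) by rewrite /b /= subnKC.
    by rewrite innerBl (inner_orthonormal_sum b_orth b_norm) subrr.
  (* Eigenvectors for the distinct eigenvalues mu^2 and (s k)^2. *)
  have : inner (adjoint T (T (x - z))) (e k) = inner (x - z) (adjoint T (T (e k))).
    exact: adjoint_comp_sym.
  rewrite Ay (ss_eigen es) innerZl innerZr rc_conj_of => /eqP.
  rewrite -subr_eq0 -mulrBl mulf_eq0 -rmorphB fmorph_eq0 subr_eq0 => /orP[|/eqP//].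
  by rewrite eqrXn2 ?(ltW mu0) ?(ss_ge0 es)// => /eqP e0; have := lt_a _ ka; rewrite -e0 ltxx.
apply/eqP; apply: contraTT yc => y0; rewrite -ltNge.
have n0 := rnorm_gt0 y0.
suff -> : rnorm (T (x - z)) = mu * rnorm (x - z) by rewrite ltr_pM2r.
apply/eqP; rewrite -(@eqrXn2 _ 2) ?rnorm_ge0 ?mulr_ge0 ?rnorm_ge0 ?(ltW mu0)//.
by rewrite rnorm_op2// Ay innerZl rc_reZ re_innerxx exprMn.
Qed.

End singular_system_theory.

(** * The Schatten classes are ideals *)

(** The min-max argument: some nonzero x in the span of the first n + 1 right
    singular vectors of A T B has an image B x orthogonal to the first n right
    singular vectors of T. *)
Lemma singular_system_comp_le (X Y Z V : hilbertType K)
    (A : Z -> V) (T : Y -> Z) (B : X -> Y) (a b : R) e s e' s' :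
  bounded_op A -> bounded_op T -> bounded_op B -> 0 <= a -> 0 <= b ->
  (forall x, rnorm (A x) <= a * rnorm x) ->
  (forall x, rnorm (B x) <= b * rnorm x) ->
  singular_system T e s -> singular_system (A \o T \o B) e' s' ->
  forall n, s' n <= a * b * s n.
Proof.
move=> Ab Tb Bb a0 b0 Aa BB es es' n.
have Bl := Bb.1.
have ATBb : bounded_op (A \o T \o B).
  by apply: bounded_op_comp Bb; exact: bounded_op_comp.
have [sn_le0|sn] := lerP (s' n) 0.
  by rewrite (le_trans sn_le0)// !mulr_ge0// (ss_ge0 es).
have [c [i ci] cM] := exists_row_kernel
  (fun (i : 'I_n.+1) (j : 'I_n) => inner (B (e' i)) (e j)) (ltnSn n).
pose x := \sum_i c i *: e' i.
have x0 : 0 < rnorm x.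
  apply: rnorm_gt0; apply: contra_neq ci => x0.
  have <- : inner x (e' i) = c i.
    have e_orth (j k : 'I_n.+1) : j != k -> inner (e' j) (e' k) = 0.
      exact: (ss_orth es').
    apply: (inner_orthonormal_sum e_orth) => j.
    by apply: (ss_norm es'); rewrite (lt_le_trans sn)// (ss_noninc es')// -ltnS.
  by rewrite x0 inner0l.
rewrite -(ler_pM2r x0) (le_trans (singular_system_lower ATBb es' c sn))//=.
rewrite -/x (le_trans (Aa _))// -!mulrA ler_wpM2l// mulrCA.
apply: (@le_trans _ _ (s n * rnorm (B x))); last first.
  by rewrite ler_wpM2l ?(ss_ge0 es).
apply: (ss_max es) => j jn; rewrite (linop_sum Bl) inner_suml -[RHS](cM (Ordinal jn)).
by apply: eq_bigr => k _; rewrite (linopZ Bl) innerZl.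
Qed.

Lemma schatten_comp (X Y Z V : hilbertType K) (p : R)
    (A : Z -> V) (T : Y -> Z) (B : X -> Y) : 0 < p ->
  bounded_op A -> bounded_op T -> bounded_op B ->
  schatten p T -> schatten p (A \o T \o B).
Proof.
move=> p0 Ab Tb Bb [Tc [s0 [sT0 s0p]]].
have ATBc : compact_op (A \o T \o B) by exact: compact_op_comp.
have ATBb : bounded_op (A \o T \o B).
  by apply: bounded_op_comp Bb; exact: bounded_op_comp.
have [_ [a a0 Aa]] := (bounded_opP A).1 Ab.
have [_ [b b0 BB]] := (bounded_opP B).1 Bb.
have [e [s es]] := exists_singular_system Tb Tc.
have [e' [s' es']] := exists_singular_system ATBb ATBc.
split=> //; exists s'; split; first exact: singular_system_values es'.
have s0s := singular_values_unique sT0 (singular_system_values Tb es).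
rewrite s0s in s0p.
have s's := singular_system_comp_le Ab Tb Bb (ltW a0) (ltW b0) Aa BB es es'.
apply: (@le_lt_trans _ _ (\sum_(0 <= n <oo) (((a * b) `^ p)%:E * (s n `^ p)%:E)))%E.
  apply: lee_nneseries => n _; first by rewrite lee_fin powR_ge0.
  rewrite -EFinM lee_fin -powRM ?mulr_ge0 ?(ltW a0) ?(ltW b0) ?(ss_ge0 es)//.
  by rewrite ge0_ler_powR ?nnegrE ?(ltW p0) ?mulr_ge0 ?(ltW a0) ?(ltW b0)
    ?(ss_ge0 es) ?(ss_ge0 es').
rewrite nneseriesZl; last by move=> n _; rewrite lee_fin powR_ge0.
by rewrite lte_mul_pinfty// lee_fin powR_ge0.
Qed.

Section ideal.
Variables (X Y Z V : hilbertType K) (A : Z -> V) (A' : V -> Z) (B : X -> Y).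
Variables (B' : Y -> X) (T : Y -> Z).
Hypotheses (Ab : bounded_op A) (A'b : bounded_op A') (Bb : bounded_op B).
Hypotheses (B'b : bounded_op B') (Tb : bounded_op T).
Hypotheses (AK : cancel A A') (BK : cancel B' B).

Let sandwich : T = A' \o (A \o T \o B) \o B'.
Proof. by apply/funext => y; rewrite /= AK BK. Qed.

(** An operator ideal contains T exactly when it contains A T B, as soon as A
    has a bounded left inverse A' and B a bounded right inverse B'. *)
Lemma compact_op_sandwich : compact_op T <-> compact_op (A \o T \o B).
Proof.
split; first exact: compact_op_comp.
by move=> h; rewrite sandwich; exact: compact_op_comp.
Qed.

Lemma schatten_sandwich (p : R) : 0 < p ->
  schatten p T <-> schatten p (A \o T \o B).
Proof.
move=> p0; split; first exact: schatten_comp.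
move=> h; rewrite sandwich; apply: schatten_comp => //.
by apply: bounded_op_comp Bb; exact: bounded_op_comp.
Qed.

End ideal.

End singular_values.

(** * Inverses and square roots of coercive operators *)

Section coercive.
Variables (R : realType) (K : rclike R) (H : hilbertType K).

Lemma cvg_innerr (T : Type) (F : set_system T) (FF : Filter F)
    (f : T -> H) (l y : H) :
  f @ F --> l -> (fun t => inner y (f t) : K^o) @ F --> (inner y l : K^o).
Proof.
move=> fl; have h : (fun t => inner (f t) y : K^o) @ F --> (inner l y : K^o).
  exact: cvg_inner.
move/cvgrPdist_lt : h => h; apply/cvgrPdist_lt => e e0.
apply: filterS (h e e0) => t; rewrite (inner_conj y) (inner_conj y (f t)).
by rewrite -rmorphB/= rc_norm_conj.
Qed.

(** Iterating z := y + X z is the Neumann series for (1 - X)^-1 y. *)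
Lemma neumann (X : H -> H) (q : R) (y : H) : linear X -> 0 <= q -> q < 1 ->
  (forall x, rnorm (X x) <= q * rnorm x) -> exists z, z = y + X z.
Proof.
move=> Xl q0 q1 Xq; pose z n := iter n (fun u => y + X u) 0.
have zq n : rnorm (z n.+1 - z n) <= rnorm y * q ^+ n.
  elim: n => [|n IH]; first by rewrite /z /= (linop0 Xl) addr0 subr0 mulr1.
  have -> : z n.+2 - z n.+1 = X (z n.+1 - z n).
    transitivity ((y + X (z n.+1)) - (y + X (z n))) => //.
    by rewrite opprD addrACA subrr add0r (linopB Xl).
  rewrite (le_trans (Xq _))//.
  by rewrite exprS mulrCA ler_wpM2l.
have [l zl] := geometric_cvg q0 q1 zq; exists l.
have [_ Xc] : bounded_op X.
  apply/bounded_opP; split=> //; exists 1 => // x.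
  by rewrite (le_trans (Xq x))// ler_wpM2r ?rnorm_ge0// ltW.
have h1 : (fun n => z n.+1) @ \oo --> l by move: zl; rewrite -(cvg_shiftS z).
have h2 : (fun n => z n.+1) @ \oo --> y + X l.
  by apply: cvgD; [exact: cvg_cst|exact: cvg_comp zl (Xc l)].
by have hd := @norm_hausdorff K H; rewrite -[LHS](cvg_lim hd h1) -[RHS](cvg_lim hd h2).
Qed.

(** The claim is what the positivity of X at x - q^-1 X x says once the bound
    q is applied at x and at X x. *)
Lemma symmetric_norm_le (X : H -> H) (q : R) : linear X ->
  (forall x y, inner (X x) y = inner x (X y)) -> 0 < q ->
  (forall x, 0 <= rc_re (inner (X x) x) <= q * rnorm x ^+ 2) ->
  forall x, rnorm (X x) <= q * rnorm x.
Proof.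
move=> Xl Xs q0 Xq x; apply: le_of_sqr; first by rewrite mulr_ge0 ?rnorm_ge0 ?ltW.
have /andP[+ _] := Xq (x - rc_of K q^-1 *: X x).
have /andP[_ h2] := Xq x; have /andP[_ h3] := Xq (X x).
rewrite (linopB Xl) (linopZ Xl) innerBl !innerBr !innerZl !innerZr rc_conj_of.
rewrite (Xs (X x) x) !rc_reB !rc_reZ re_innerxx.
move: h2 h3; set a := rc_re (inner (X x) x); set b := rc_re (inner (X (X x)) (X x)).
set m := rnorm (X x) ^+ 2; set n := rnorm x ^+ 2 => h2 h3 h1.
have h4 : q^-1 * (q^-1 * b) <= q^-1 * (q^-1 * (q * m)).
  by rewrite !ler_pM2l ?invr_gt0.
rewrite mulKf ?gt_eqF// in h4.
have h5 : 0 <= q * (q * n - q^-1 * m).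
  by apply: mulr_ge0; [exact: ltW|move: h1 h2 h4; rewrite -/m; lra].
move: h5; rewrite mulrBr mulVKf ?gt_eqF// subr_ge0 exprMn.
by rewrite mulrA -expr2.
Qed.

Variables (S : H -> H) (a : R).
Hypotheses (Sb : bounded_op S) (Ss : forall x y, inner (S x) y = inner x (S y)).
Hypotheses (a0 : 0 < a) (Sa : forall x, a * rnorm x ^+ 2 <= rc_re (inner (S x) x)).

(** Dividing S by the sum B of its lower and upper bounds moves its spectrum
    into an interval symmetric about 1/2 and away from 0 and 1, so that
    X = 1 - S / B is a positive contraction. *)
Lemma coercive_scaling : exists (B q : R) (X : H -> H),
  [/\ [/\ 0 < B, 0 < q & q < 1], linear X,
    forall x y, inner (X x) y = inner x (X y),
    forall x, rnorm (X x) <= q * rnorm x &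
    forall x, S x = rc_of K B *: (x - X x)].
Proof.
have [Sl [M M0 SM]] := (bounded_opP S).1 Sb.
have B0 : 0 < a + M by rewrite addr_gt0.
have BK : rc_of K (a + M) * rc_of K (a + M)^-1 = 1.
  by rewrite -rmorphM mulfV ?rmorph1// gt_eqF.
pose X x := x - rc_of K (a + M)^-1 *: S x.
have Xl : linear X.
  move=> c x y; rewrite /X Sl scalerDr !scalerA mulrC -scalerA opprD addrACA.
  by rewrite -scalerBr.
have Xs x y : inner (X x) y = inner x (X y).
  by rewrite innerBl innerBr innerZl innerZr rc_conj_of Ss.
have q0 : 0 < M / (a + M) by rewrite divr_gt0.
exists (a + M), (M / (a + M)), X; split=> //.
- by split=> //; rewrite ltr_pdivrMr// mul1r ltrDr.
- apply: symmetric_norm_le => // x; rewrite innerBl innerZl rc_reB rc_reZ re_innerxx.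
  rewrite subr_ge0 ler_pdivrMl//.
  have h : rc_re (inner (S x) x) <= M * rnorm x ^+ 2.
    by rewrite (le_trans (re_inner_le _ _))// expr2 mulrA ler_wpM2r ?rnorm_ge0.
  apply/andP; split.
    by rewrite (le_trans h)// ler_wpM2r ?sqr_ge0// lerDr ltW.
  set r := rnorm x ^+ 2.
  have {h} -> : M / (a + M) * r = r - (a + M)^-1 * (a * r) by field; rewrite gt_eqF.
  by rewrite lerD2l lerN2 ler_pM2l ?invr_gt0//; exact: Sa.
- by move=> x; rewrite /X subKr scalerA BK scale1r.
Qed.

(** The equation S z = y amounts to z = B^-1 y + X z. *)
Lemma coercive_inverse : exists2 P : H -> H, bounded_op P &
  (forall y, S (P y) = y) /\ (forall x, P (S x) = x).
Proof.
have Sl := Sb.1.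
have lower x : a * rnorm x <= rnorm (S x).
  have [->|/rnorm_gt0 x0] := eqVneq x 0; first by rewrite (linop0 Sl) !rnorm0 mulr0.
  by rewrite -(ler_pM2r x0) -mulrA -expr2 (le_trans (Sa x))// re_inner_le.
have Sinj : injective S.
  move=> x y Sxy; apply/eqP; rewrite -subr_eq0; apply/eqP/rnorm_eq0/eqP.
  rewrite eq_le rnorm_ge0 andbT -(ler_pM2l a0) mulr0 (le_trans (lower _))//.
  by rewrite (linopB Sl) Sxy subrr rnorm0.
have [B [q [X [[B0 q0 q1] Xl _ Xq SE]]]] := coercive_scaling.
have /choice[P SP] : forall y, exists z, S z = y.
  move=> y; have [z ze] := neumann (rc_of K B^-1 *: y) Xl (ltW q0) q1 Xq.
  exists z; rewrite SE {1}ze addrK scalerA -rmorphM mulfV ?gt_eqF//.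
  by rewrite rmorph1 scale1r.
exists P; last by split=> // x; apply: Sinj.
apply/bounded_opP; split=> [c x y|]; first by apply: Sinj; rewrite Sl !SP.
exists a^-1 => [|y]; first by rewrite invr_gt0.
by rewrite -(ler_pM2l a0) mulVKf ?gt_eqF// -{2}(SP y).
Qed.

(** With S = B (1 - X), a square root is B^(1/2) (1 - Y) where
    Y = (X + Y^2) / 2, which is the limit of the corresponding iteration: it
    maps operators of norm at most q to such operators and contracts. *)
Lemma exists_op_sqrt : exists Q, positive_op Q /\ Q \o Q = S.
Proof.
have [B [q [X [[B0 q0 q1] Xl Xs Xq SE]]]] := coercive_scaling.
have halfK : rc_of K 2^-1 + rc_of K 2^-1 = 1.
  by rewrite -rmorphD (_ : 2^-1 + 2^-1 = 1) ?rmorph1//; field.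
pose step (Y : H -> H) x := rc_of K 2^-1 *: (X x + Y (Y x)).
pose Y n := iter n step (fun=> 0).
have Yl n : linear (Y n).
  elim: n => [|n IH] c x y; first by rewrite scaler0 addr0.
  by rewrite /= /step Xl !IH addrACA -(scalerDr c) (scalerDr (rc_of K 2^-1)) !scalerA (mulrC c).
have Ys n x y : inner (Y n x) y = inner x (Y n y).
  elim: n x y => [|n IH] x y; first by rewrite inner0l inner0r.
  by rewrite /= /step innerZl innerZr rc_conj_of innerDl innerDr Xs !IH.
have half0 : `|2^-1 : R| = 2^-1 by rewrite gtr0_norm ?invr_gt0.
have Yq n x : rnorm (Y n x) <= q * rnorm x.
  elim: n x => [|n IH] x; first by rewrite rnorm0 mulr_ge0 ?rnorm_ge0 ?ltW.
  rewrite /= /step rnormZr half0 ler_pdivrMl//.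
  have h1 := rnormD (X x) (Y n (Y n x)).
  have h2 := Xq x; have h3 := IH (Y n x).
  have h4 : q * rnorm (Y n x) <= q * rnorm x.
    by rewrite ler_pM2l// (le_trans (IH _))// ler_piMl ?rnorm_ge0// ltW.
  by move: h1 h2 h3 h4; lra.
have Yd n x : rnorm (Y n.+1 x - Y n x) <= rnorm x * q ^+ n.
  elim: n x => [|n IH] x.
    by rewrite subr0 mulr1 (le_trans (Yq 1%N x))// ler_piMl ?rnorm_ge0// ltW.
  have -> : Y n.+2 x - Y n.+1 x = rc_of K 2^-1 *:
      (Y n.+1 (Y n.+1 x - Y n x) + (Y n.+1 (Y n x) - Y n (Y n x))).
    transitivity (step (Y n.+1) x - step (Y n) x) => //.
    by rewrite /step -scalerBr opprD addrACA subrr add0r (linopB (Yl n.+1)) subrKA.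
  rewrite rnormZr half0 ler_pdivrMl//.
  have h1 := rnormD (Y n.+1 (Y n.+1 x - Y n x)) (Y n.+1 (Y n x) - Y n (Y n x)).
  have h2 := Yq n.+1 (Y n.+1 x - Y n x).
  have h3 : q * rnorm (Y n.+1 x - Y n x) <= q * (rnorm x * q ^+ n).
    by rewrite ler_pM2l.
  have h4 := IH (Y n x).
  have h5 : rnorm (Y n x) * q ^+ n <= q * rnorm x * q ^+ n.
    by rewrite ler_wpM2r ?exprn_ge0// ltW.
  by rewrite exprS; move: h1 h2 h3 h4 h5; lra.
have /choice[Z YZ] : forall x, exists l : H, (fun n => Y n x) @ \oo --> l.
  by move=> x; exact: geometric_cvg (ltW q0) q1 (Yd ^~ x).
have hd := @norm_hausdorff K H.
have Zl : linear Z.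
  move=> c x y; rewrite -[LHS](cvg_lim hd (YZ _)); apply: cvg_lim => //.
  have -> : (fun n => Y n (c *: x + y)) = (fun n => c *: Y n x + Y n y).
    by apply/funext => n; rewrite Yl.
  by apply: cvgD => //; exact: cvgZl_tmp.
have Zq x : rnorm (Z x) <= q * rnorm x.
  have h : (fun n => rnorm (Y n x)) @ \oo --> rnorm (Z x) by exact: cvg_rnorm.
  by apply: (cvgr_to_le h); apply: nearW => n; exact: Yq.
have Zs x y : inner (Z x) y = inner x (Z y).
  have hK := @norm_hausdorff K K^o.
  have h1 : (fun n => inner (Y n x) y : K^o) @ \oo --> (inner (Z x) y : K^o).
    exact: cvg_inner.
  have h2 : (fun n => inner (Y n x) y : K^o) @ \oo --> (inner x (Z y) : K^o).
    have -> : (fun n => inner (Y n x) y) = (fun n => inner x (Y n y)).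
      by apply/funext => n; rewrite Ys.
    exact: cvg_innerr.
  by rewrite -[LHS](cvg_lim hK h1) -[RHS](cvg_lim hK h2).
have Zfix x : Z x = rc_of K 2^-1 *: (X x + Z (Z x)).
  have h1 : (fun n => Y n.+1 x) @ \oo --> Z x.
    by have := YZ x; rewrite -(cvg_shiftS (fun n => Y n x)).
  rewrite -[LHS](cvg_lim hd h1); apply: cvg_lim => //.
  apply: cvgZl_tmp; apply: cvgD; first exact: cvg_cst.
  have -> : (fun n => Y n (Y n x)) = (fun n => Y n (Y n x - Z x) + Y n (Z x)).
    by apply/funext => n; rewrite (linopB (Yl n)) subrK.
  rewrite -[Z (Z x)]add0r; apply: cvgD => //.
  apply/cvg_rnormP => e e0; have /cvg_rnormP/(_ _ e0) := YZ x.
  apply: filterS => n h; rewrite sub0r rnormN (le_lt_trans (Yq _ _))//.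
  by rewrite rnormBC (le_lt_trans _ h)// ler_piMl ?rnorm_ge0// ltW.
pose Q x := rc_of K (Num.sqrt B) *: (x - Z x).
have Ql : linear Q.
  by move=> c x y; rewrite /Q Zl opprD addrACA -(scalerBr c) (scalerDr (rc_of K _)) !scalerA (mulrC c).
have Qs x y : inner (Q x) y = inner x (Q y).
  by rewrite innerZl innerZr rc_conj_of innerBl innerBr Zs.
exists Q; split; last first.
  apply/funext => x /=; rewrite SE /Q.
  rewrite -/(Q x) (linopZ Zl) -scalerBr scalerA -rmorphM -expr2 sqr_sqrtr ?ltW//.
  congr (_ *: _); rewrite (linopB Zl).
  have -> : X x = Z x + Z x - Z (Z x).
    by rewrite {1 2}Zfix -scalerDl halfK scale1r addrK.
  by rewrite !opprD !opprK !addrA.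
split=> //.
  apply/bounded_opP; split=> //; exists (Num.sqrt B * 2) => [|x].
    by rewrite mulr_gt0 ?sqrtr_gt0.
  rewrite rnormZr ger0_norm ?sqrtr_ge0// -mulrA ler_wpM2l ?sqrtr_ge0//.
  have h1 := rnormB_le x (Z x); have h2 := Zq x; have h3 := rnorm_ge0 x.
  have h4 : q * rnorm x <= rnorm x by rewrite ler_piMl// ltW.
  by move: h1 h2 h3 h4; lra.
move=> x; have <- : rc_of K (rc_re (inner (Q x) x)) = inner (Q x) x.
  rewrite rc_reE -inner_conj -Qs -mulr2n -(mulr_natr (inner _ _)).
  by rewrite mulfK ?pnatr_eq0.
rewrite rc_of_ge0 innerZl rc_reZ mulr_ge0 ?sqrtr_ge0// innerBl rc_reB subr_ge0.
rewrite re_innerxx (le_trans (re_inner_le _ _))// expr2 ler_wpM2r ?rnorm_ge0//.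
by rewrite (le_trans (Zq _))// ler_piMl ?rnorm_ge0// ltW.
Qed.

(** The inverse of Q is Q S^-1 for every Q with Q^2 = S. *)
Lemma op_inv_sqrtP :
  [/\ bounded_op (op_sqrt S), bounded_op (op_inv (op_sqrt S)),
    cancel (op_sqrt S) (op_inv (op_sqrt S)) &
    cancel (op_inv (op_sqrt S)) (op_sqrt S)].
Proof.
have [P Pb [SP PS]] := coercive_inverse.
have [[Qb _ _] QQ] : positive_op (op_sqrt S) /\ op_sqrt S \o op_sqrt S = S.
  have [Q0 Q0P] := exists_op_sqrt.
  by rewrite /op_sqrt; case: xgetP => [Q _ //|] /(_ Q0)/(_ Q0P).
set Q := op_sqrt S in Qb QQ *.
have QQE x : Q (Q x) = S x by rewrite -QQ.
have Qinj : injective Q.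
  by move=> x y Qxy; rewrite -(PS x) -(PS y) -!QQE Qxy.
have QK y : Q (Q (P y)) = y by rewrite QQE.
have invQ y : op_inv Q y = Q (P y).
  rewrite -{1}(QK y) /op_inv.
  by rewrite pinvKV//; [move=> u v _ _; exact: Qinj|exact: in_setT].
have invE : op_inv Q = Q \o P by apply/funext.
split=> //; first by rewrite invE; exact: bounded_op_comp.
  by move=> x; apply: Qinj; rewrite invE /= QK.
by move=> y; rewrite invE /= QK.
Qed.

End coercive.

(** * Fusion sequences *)

Section fusion.
Variables (R : realType) (K : rclike R) (H : hilbertType K) (I : choiceType).

Lemma orth_proj_linear (U : closed_subspace H) : linear (orth_proj U).
Proof.
move=> a x y; have [Ux xP] := orth_projP U x; have [Uy yP] := orth_projP U y.
apply: orth_proj_unique; first exact: cs_lin.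
move=> u Uu; rewrite opprD addrACA -scalerBr innerDl innerZl xP// yP//.
by rewrite mulr0 addr0.
Qed.

Section truncation.
Variables (U : I -> closed_subspace H) (g : ell2 U).

Let trunc (J : {fset I}) (i : I) : H := if i \in J then g i else 0.

Let trunc_in (J : {fset I}) : trunc J \in ell2_pred U.
Proof.
apply/asboolP; split=> [i|].
  by rewrite /trunc; case: ifP => _; [exact: ell2U|exact: cs_zero].
apply: le_lt_trans (ell2_lty g); apply: le_esum => i _.
rewrite lee_fin /trunc; case: ifP => // _.
by rewrite rnorm0 expr0n sqr_ge0.
Qed.

Definition ell2_trunc (J : {fset I}) : ell2 U := Ell2 (trunc_in J).

Lemma ell2_truncE J i : ell2_trunc J i = if i \in J then g i else 0.
Proof. by []. Qed.

Lemma ell2_trunc_nsq (J : {fset I}) :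
  ell2_nsq (g - ell2_trunc J) <= ell2_nsq g - \sum_(i <- J) rnorm (g i) ^+ 2.
Proof.
rewrite -lee_fin -ell2_nsqE; apply: esum_le_fset => L; rewrite lerBrDr.
apply: le_trans (ell2_le g (L `|` J)%fset).
rewrite [leRHS](big_fsetID _ (mem J))/=.
have -> : [fset i | i in (L `|` J)%fset & i \in J]%fset = J.
  by apply/fsetP => i; rewrite !inE/=; case: (i \in J); rewrite ?orbT ?andbF.
rewrite [leRHS]addrC lerD2r [leLHS](big_fsetID _ (mem J))/=.
rewrite big_seq big1 ?add0r => [|i]; last first.
  rewrite !inE/= => /andP[_ iJ].
  rewrite [X in rnorm X](_ : _ = g i - ell2_trunc J i)//.
  by rewrite ell2_truncE iJ subrr rnorm0 expr0n.
have -> : [fset i | i in (L `|` J)%fset & i \notin J]%fset =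
    [fset i | i in L & i \notin J]%fset.
  by apply/fsetP => i; rewrite !inE/=; case: (i \in J); rewrite ?andbF ?orbF.
rewrite [leLHS]big_seq [leRHS]big_seq; apply: ler_sum => i.
rewrite !inE/= => /andP[_ /negbTE iJ].
rewrite [X in rnorm X ^+ 2 <= _](_ : _ = g i - ell2_trunc J i)//.
by rewrite ell2_truncE iJ subr0.
Qed.

Lemma ell2_trunc_cvg : ell2_trunc @ @totally I --> g.
Proof.
apply/cvg_rnormP => e e0; have e2 : 0 < e ^+ 2 by rewrite exprn_gt0.
have /cvgrPdist_lt/(_ _ e2) := @cvg_ell2_nsq _ _ _ _ _ g; apply: filterS => J.
rewrite ger0_norm ?subr_ge0 ?ell2_le// => h.
rewrite -(@ltr_pXn2r _ 2)// ?nnegrE ?rnorm_ge0 ?ltW//.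
by rewrite -ell2_nsq_rnorm (le_lt_trans (ell2_trunc_nsq J)).
Qed.

Lemma inner_ell2_trunc (f : ell2 U) (J : {fset I}) :
  inner f (ell2_trunc J) = \sum_(i <- J) inner (f i) (g i) :> K.
Proof.
apply: ell2_inner_lim; apply: cvg_near_cst; exists J => // L /= JL.
rewrite (big_fsetID _ (mem J))/=.
have -> : [fset i | i in L & i \in J]%fset = J.
  apply/fsetP => i; rewrite !inE/= andbC.
  by have [/(fsubsetP JL)|] := boolP (i \in J).
rewrite [X in _ + X]big_seq [X in _ + X]big1 ?addr0 => [|i]; last first.
  by rewrite !inE/= => /andP[_ /negbTE iJ]; rewrite /trunc iJ inner0r.
by rewrite !big_seq; apply: eq_bigr => i iJ; rewrite /trunc iJ.
Qed.

End truncation.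

Section bessel.
Variables (W : weighted_family H I) (Wb : bessel_fusion W).
Local Notation U := (wf_space W).
Local Notation w := (wf_weight W).

Let analysis_fun (f : H) (i : I) : H := rc_of K (w i) *: orth_proj (U i) f.

Let analysis_fun_rnorm f i : rnorm (analysis_fun f i) ^+ 2 =
  w i ^+ 2 * rnorm (orth_proj (U i) f) ^+ 2.
Proof. by rewrite rnormZr exprMn real_normK ?num_real. Qed.

Let analysis_in f : analysis_fun f \in ell2_pred U.
Proof.
apply/asboolP; split=> [i|].
  by apply: csZ; case: (orth_projP (U i) f).
have [B BW] := Wb; apply: le_lt_trans (le_trans _ (BW f)) (ltry _).
by apply: le_esum => i _; rewrite analysis_fun_rnorm.
Qed.

Definition analysis (f : H) : ell2 U := Ell2 (analysis_in f).

Lemma fusion_energyE f : fusion_energy W f = (rnorm (analysis f) ^+ 2)%:E.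
Proof.
rewrite -ell2_nsq_rnorm -ell2_nsqE; apply: eq_esum => i _.
by rewrite analysis_fun_rnorm.
Qed.

Lemma analysis_bounded : bounded_op analysis.
Proof.
apply/bounded_opP; split=> [a x y|].
  apply: ell2_ext => i; rewrite ell2D ell2Z /= /analysis_fun.
  by rewrite orth_proj_linear scalerDr !scalerA mulrC.
have [B BW] := Wb; exists (Num.sqrt `|B| + 1) => [|f].
  by rewrite ltr_wpDl ?sqrtr_ge0.
apply: (@le_trans _ _ (Num.sqrt `|B| * rnorm f)); last first.
  by rewrite ler_wpM2r ?rnorm_ge0// lerDl.
apply: le_of_sqr; first by rewrite mulr_ge0 ?sqrtr_ge0 ?rnorm_ge0.
rewrite exprMn sqr_sqrtr// -lee_fin -fusion_energyE (le_trans (BW f))//.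
by rewrite lee_fin ler_wpM2r ?sqr_ge0// ler_norm.
Qed.

Lemma adjoint_analysis_trunc (g : ell2 U) (J : {fset I}) :
  adjoint analysis (ell2_trunc g J) = \sum_(i <- J) rc_of K (w i) *: g i.
Proof.
apply: inner_ext => z; rewrite -adjointP; last exact: analysis_bounded.
rewrite inner_ell2_trunc inner_sumr; apply: eq_bigr => i _.
rewrite innerZl innerZr rc_conj_of; congr (_ * _).
have [_ /(_ _ (ell2U g i))] := orth_projP (U i) z.
by rewrite innerBl => /eqP; rewrite subr_eq0 => /eqP.
Qed.

(** The partial sums defining the synthesis of g are the values of the adjoint
    at the truncations of g, which converge to g. *)
Lemma synthesisE : synthesis W = adjoint analysis.
Proof.
apply/funext => g; apply: cvg_lim; first exact: norm_hausdorff.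
have [_ Tc] := adjoint_bounded analysis_bounded.
have h : adjoint analysis (ell2_trunc g J) @[J --> @totally I] -->
    adjoint analysis g by exact: cvg_comp (@ell2_trunc_cvg U g) (Tc g).
apply: cvg_trans h; apply: near_eq_cvg; apply: nearW => J.
by rewrite adjoint_analysis_trunc.
Qed.

Lemma synthesis_bounded : bounded_op (synthesis W).
Proof. by rewrite synthesisE; exact: adjoint_bounded analysis_bounded. Qed.

Lemma inner_synthesis f g : inner (synthesis W g) f = inner g (analysis f) :> K.
Proof.
rewrite inner_conj synthesisE -adjointP; last exact: analysis_bounded.
by rewrite -inner_conj.
Qed.

Lemma adjoint_synthesis : adjoint (synthesis W) = analysis.
Proof.
apply: adjoint_unique; first exact: synthesis_bounded.
by move=> g f; exact: inner_synthesis.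
Qed.

Lemma frame_opE f : frame_op W f = synthesis W (analysis f).
Proof. by rewrite /frame_op adjoint_synthesis. Qed.

Lemma frame_op_bounded : bounded_op (frame_op W).
Proof.
rewrite /frame_op adjoint_synthesis.
exact: bounded_op_comp synthesis_bounded analysis_bounded.
Qed.

Lemma frame_op_sym x y : inner (frame_op W x) y = inner x (frame_op W y).
Proof.
rewrite !frame_opE inner_synthesis [RHS]inner_conj inner_synthesis.
by rewrite -inner_conj.
Qed.

Lemma frame_op_coercive : fusion_frame W -> exists2 a : R, 0 < a &
  forall x, a * rnorm x ^+ 2 <= rc_re (inner (frame_op W x) x).
Proof.
move=> [_ [a a0 aW]]; exists a => // x.
by rewrite frame_opE inner_synthesis re_innerxx -lee_fin -fusion_energyE.
Qed.

End bessel.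

End fusion.

Theorem lemma5p1 (R : realType) (K : rclike R) (H : hilbertType K)
    (I : choiceType) (W V : weighted_family H I) (O : H -> H) (p : R)
    (p_gt0 : 0 < p) (W_bessel : bessel_fusion W) (V_bessel : bessel_fusion V)
    (O_bounded : bounded_op O) :
  (compact_op O -> compact_op (frame_matrix W V O)) /\
  (schatten p O -> schatten p (frame_matrix W V O)) /\
  (fusion_frame W -> fusion_frame V ->
     (compact_op O <-> compact_op (frame_matrix W V O)) /\
     (compact_op O <-> compact_op (frame_matrix_tensor W V O)) /\
     (schatten p O <-> schatten p (frame_matrix W V O)) /\
     (schatten p O <-> schatten p (frame_matrix_tensor W V O))).
Proof.
have CWb := analysis_bounded W_bessel; have CVb := analysis_bounded V_bessel.
have TWb := synthesis_bounded W_bessel; have TVb := synthesis_bounded V_bessel.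
rewrite /frame_matrix /frame_matrix_tensor (adjoint_synthesis W_bessel).
split; first exact: compact_op_comp.
split; first exact: schatten_comp.
move=> W_frame V_frame.
have [a a0 Wa] := frame_op_coercive W_bessel W_frame.
have [b b0 Vb] := frame_op_coercive V_bessel V_frame.
have SWb := frame_op_bounded W_bessel; have SVb := frame_op_bounded V_bessel.
have SWs := frame_op_sym W_bessel; have SVs := frame_op_sym V_bessel.
have [PW PWb [_ PSW]] := coercive_inverse SWb SWs a0 Wa.
have [PV PVb [SPV _]] := coercive_inverse SVb SVs b0 Vb.
have [QWb JWb _ JWK] := op_inv_sqrtP SWb SWs a0 Wa.
have [QVb JVb QVK _] := op_inv_sqrtP SVb SVs b0 Vb.
(* In the names below, C is an analysis and T a synthesis operator, P inverts a
   frame operator, Q is its square root and J the inverse of Q. *)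
have CWK : cancel (analysis W_bessel) (PW \o synthesis W).
  by move=> x /=; rewrite -frame_opE PSW.
have TVK : cancel (analysis V_bessel \o PV) (synthesis V).
  by move=> x /=; rewrite -frame_opE SPV.
have LWb := bounded_op_comp PWb TWb; have RVb := bounded_op_comp CVb PVb.
have CJK : cancel (analysis W_bessel \o op_inv (op_sqrt (frame_op W)))
    (op_sqrt (frame_op W) \o (PW \o synthesis W)).
  by move=> x; rewrite /= [PW _]CWK JWK.
have JTK : cancel ((analysis V_bessel \o PV) \o op_sqrt (frame_op V))
    (op_inv (op_sqrt (frame_op V)) \o synthesis V).
  by move=> x; rewrite /= [synthesis V _]TVK QVK.
have LQWb := bounded_op_comp QWb LWb; have RQVb := bounded_op_comp RVb QVb.
have CJb := bounded_op_comp CWb JWb; have JTb := bounded_op_comp JVb TVb.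
split; first exact: (compact_op_sandwich O CWb LWb TVb RVb CWK TVK).
split; first exact: (compact_op_sandwich O CJb LQWb JTb RQVb CJK JTK).
split; first exact: (schatten_sandwich CWb LWb TVb RVb O_bounded CWK TVK p_gt0).
exact: (schatten_sandwich CJb LQWb JTb RQVb O_bounded CJK JTK p_gt0).
Qed.
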